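(* Let $\lVert \cdot \rVert_A$ and $\lVert \cdot \rVert_B$ be rearrangement-invariant quasi-Banach function norms over a non-atomic measure space $(\mathcal{R},\mu)$ of infinite measure. Then $$A \cap B \hookrightarrow WL(A,B) \hookrightarrow A + B .$$ Moreover, if in addition the local component of $\lVert \cdot \rVert_A$ is stronger than that of $\lVert \cdot \rVert_B$ while the global component of $\lVert \cdot \rVert_B$ is stronger than that of $\lVert \cdot \rVert_A$, then $$A \cap B = WL(A,B), \qquad A + B = WL(B,A),$$ in both cases up to equivalence of quasinorms.
   Context: Measure spaces are $\sigma$-finite. $\lambda$ is Lebesgue measure on $[0,\infty)$. $\mathcal{M}(\mathcal{R},\mu)$ is the set of ($\mu$-a.e. equivalence classes of) measurable functions on $\mathcal{R}$ (infinite values are allowed), and $\mathcal{M}_+$ its cone of non-negative functions. The non-increasing rearrangement of $f$ is $f^*(t)=\inf\{s\ge 0:\ \mu(\{|f|>s\})\le t\}$, $t\in[0,\infty)$. An r.i. quasi-Banach function norm is a functional $\lVert\cdot\rVert:\mathcal{M}(\mathcal{R},\mu)\to[0,\infty]$ with $\lVert\,|f|\,\rVert=\lVert f\rVert$ such that: (quasinorm) $\lVert af\rVert=|a|\lVert f\rVert$ for $a\in\mathbb{C}$, $f\in\mathcal{M}_+$, $\lVert f\rVert=0\Leftrightarrow f=0$ a.e., and there is $K\ge1$ with $\lVert f+g\rVert\le K(\lVert f\rVert+\lVert g\rVert)$ for all $f,g\in\mathcal{M}_+$; (lattice property) $0\le f\le g$ a.e. implies $\lVert f\rVert\le\lVert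 g\rVert$; (Fatou property) $0\le f_n\uparrow f$ a.e. implies $\lVert f_n\rVert\uparrow\lVert f\rVert$; $\lVert\chi_E\rVert<\infty$ whenever $\mu(E)<\infty$; (rearrangement-invariance) $\lVert f\rVert=\lVert g\rVert$ whenever $f^*=g^*$. The corresponding r.i. quasi-Banach function space is $X=\{f\in\mathcal{M}(\mathcal{R},\mu):\lVert f\rVert_X<\infty\}$. Intersection: $A\cap B$ with $\lVert\cdot\rVert_{A\cap B}=\max\{\lVert\cdot\rVert_A,\lVert\cdot\rVert_B\}$. Sum: $A+B=\{f: \exists f_A\in A, f_B\in B,\ f=f_A+f_B\}$ with $\lVert f\rVert_{A+B}=\inf\{\lVert f_A\rVert_A+\lVert f_B\rVert_B:\ f=f_A+f_B,\ f_A\in A,\ f_B\in B\}$ (with $\inf\emptyset=\infty$). Canonical representation quasinorm of $X$ (for $(\mathcal{R},\mu)$ non-atomic with $\mu(\mathcal{R})=\infty$): $\lVert g\rVert_{\overline{X}}=\lVert g^*\circ\sigma\rVert_X$ for $g\in\mathcal{M}([0,\infty),\lambda)$, where $\sigma:\mathcal{R}\to[0,\infty)$ is a measure-preserving map (the choice is irrelevant). It is the unique r.i. quasi-Banach function norm over $([0,\infty),\lambda)$ satisfying $\lVert f\rVert_X=\lVert f^*\rVert_{\overline{X}}$ for all $f\in\mathcal{M}(\mathcal{R},\mu)$. Wiener--Luxemburg amalgam: $\lVert f \rVert_{WL(A,B)} = \lVert f^* \chi_{[0,1]} \rVert_{\overline{A}} + \lVert f^* \chi_{(1, \infty)} \rVert_{\overline{B}}$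 for $f\in\mathcal{M}(\mathcal{R},\mu)$, and $WL(A,B)=\{f\in\mathcal{M}(\mathcal{R},\mu):\lVert f\rVert_{WL(A,B)}<\infty\}$. The local component of $\lVert\cdot\rVert_A$ is stronger than that of $\lVert\cdot\rVert_B$ if for every $f\in\mathcal{M}([0,\infty),\lambda)$: $\lVert f^*\chi_{[0,1]}\rVert_{\overline{A}}<\infty$ implies $\lVert f^*\chi_{[0,1]}\rVert_{\overline{B}}<\infty$. The global component of $\lVert\cdot\rVert_B$ is stronger than that of $\lVert\cdot\rVert_A$ if for every $f\in\mathcal{M}([0,\infty),\lambda)$ with $f^*(1)<\infty$: $\lVert f^*\chi_{(1,\infty)}\rVert_{\overline{B}}<\infty$ implies $\lVert f^*\chi_{(1,\infty)}\rVert_{\overline{A}}<\infty$. $X\hookrightarrow Y$ means there is a constant $C<\infty$ with $\lVert f\rVert_Y\le C\lVert f\rVert_X$ for all $f\in\mathcal{M}(\mathcal{R},\mu)$; equality up to equivalence of quasinorms means $X\hookrightarrow Y$ and $Y\hookrightarrow X$. *)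

(* Defs.v *)
From HB Require Import structures.
From mathcomp Require Import all_boot all_order all_algebra.
From mathcomp Require Import complex.
From mathcomp Require Import all_classical all_reals all_analysis.
From mathcomp Require Import measurable_realfun.

Set Implicit Arguments.
Unset Strict Implicit.
Unset Printing Implicit Defensive.

Import Order.TTheory GRing.Theory Num.Theory.
Import numFieldNormedType.Exports.

Local Open Scope classical_set_scope.
Local Open Scope ring_scope.
Local Open Scope ereal_scope.

Section ExtendedComplex.
Variable R : realType.

(* Values of functions: complex numbers together with one infinite value,
   [None]. *)
Definition xcomplex := option R[i].

Definition xmod (z : xcomplex) : \bar R :=
  if z is Some w then (ComplexField.Normc.normc w)%:E else +oo.

Definition xadd (z w : xcomplex) : xcomplex :=
  if z is Some a then if w is Some b then Some (a + b)%R else None else None.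

(* The convention 0 * oo = 0 is the one of the product on [\bar R]. *)
Definition xscale (a : R[i]) (z : xcomplex) : xcomplex :=
  if z is Some w then Some (a * w)%R
  else if a == 0%R then Some 0%R else None.

Definition xof (r : \bar R) : xcomplex :=
  if r is s%:E then Some (s%:C)%C else None.

Definition xRe (z : xcomplex) : \bar R :=
  if z is Some w then (complex.Re w)%:E else +oo.

Definition xIm (z : xcomplex) : \bar R :=
  if z is Some w then (complex.Im w)%:E else +oo.

End ExtendedComplex.

Section Rearrangement.
Context {R : realType} {T : Type}.

Definition xlift (h : T -> \bar R) : T -> xcomplex R := fun x => xof (h x).

Definition modulus (f : T -> xcomplex R) : T -> \bar R := fun x => xmod (f x).

(* Non-increasing rearrangement; only its values at t >= 0 are meaningful. *)
Definition rearr (mu : set T -> \bar R) (f : T -> xcomplex R) (t : R) : \bar R :=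
  ereal_inf [set s%:E | s in
    [set s : R | (0 <= s)%R /\ mu [set x | s%:E < xmod (f x)] <= t%:E]].

End Rearrangement.

Section Functions.
Context {R : realType} {d : measure_display} {T : measurableType d}.

(* Both components are +oo exactly at the infinite value, so this is
   measurability of the set {f = oo} and of the real and imaginary parts of f
   off that set. *)
Definition xmeasurable (f : T -> xcomplex R) : Prop :=
  measurable_fun [set: T] (fun x => xRe (f x) : \bar R) /\
  measurable_fun [set: T] (fun x => xIm (f x) : \bar R).

(* The cone M_+, with values in [0, +oo]; [xlift] embeds it into M. *)
Definition nonneg_measurable (h : T -> \bar R) : Prop :=
  measurable_fun [set: T] h /\ forall x, 0 <= h x.

Definition non_atomic (mu : set T -> \bar R) : Prop :=
  ~ exists E, [/\ measurable E, 0 < mu E &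
      forall F, measurable F -> F `<=` E -> mu F = 0 \/ mu F = mu E].

(* Functionals act on functions rather than on a.e. classes: axiom [rqn_lattice],
   together with [rqn_mod], makes them invariant under a.e. equality. *)
Record ri_quasi_norm (mu : {measure set T -> \bar R})
    (N : (T -> xcomplex R) -> \bar R) : Prop := RiQuasiNorm {
  rqn_ge0 : forall f, xmeasurable f -> 0 <= N f;
  rqn_mod : forall f, xmeasurable f -> N (xlift (modulus f)) = N f;
  rqn_scale : forall (a : R[i]) (h : T -> \bar R), nonneg_measurable h ->
    N (fun x => xscale a (xlift h x)) =
      (ComplexField.Normc.normc a)%:E * N (xlift h);
  rqn_eq0 : forall h, nonneg_measurable h ->
    N (xlift h) = 0 <-> {ae mu, forall x, h x = 0};
  rqn_triangle : exists K : R, (1 <= K)%R /\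
    forall g h, nonneg_measurable g -> nonneg_measurable h ->
      N (xlift (g \+ h)) <= K%:E * (N (xlift g) + N (xlift h));
  rqn_lattice : forall g h, nonneg_measurable g -> nonneg_measurable h ->
    {ae mu, forall x, g x <= h x} -> N (xlift g) <= N (xlift h);
  rqn_fatou : forall (h_ : nat -> T -> \bar R) (h : T -> \bar R),
    (forall n, nonneg_measurable (h_ n)) -> nonneg_measurable h ->
    {ae mu, forall x, nondecreasing_seq (fun n => h_ n x) /\
                      h_ n x @[n --> \oo] --> h x} ->
    nondecreasing_seq (fun n => N (xlift (h_ n))) /\
    N (xlift (h_ n)) @[n --> \oo] --> N (xlift h);
  rqn_indic : forall E, measurable E -> mu E < +oo ->
    N (xlift (fun x => (\1_E x)%:E)) < +oo;
  rqn_ri : forall f g, xmeasurable f -> xmeasurable g ->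
    (forall t : R, (0 <= t)%R -> rearr mu f t = rearr mu g t) -> N f = N g
}.

Definition in_space (N : (T -> xcomplex R) -> \bar R) (f : T -> xcomplex R) :=
  xmeasurable f /\ N f < +oo.

Definition cap_norm (A B : (T -> xcomplex R) -> \bar R) :
    (T -> xcomplex R) -> \bar R := fun f => maxe (A f) (B f).

(* Elements of [in_space A] are finite a.e. when [A] is an r.i. quasinorm, so
   the value of [xadd] at infinity plays no role here. *)
Definition sum_norm (mu : {measure set T -> \bar R})
    (A B : (T -> xcomplex R) -> \bar R) : (T -> xcomplex R) -> \bar R :=
  fun f => ereal_inf [set r | exists fA fB,
    [/\ in_space A fA, in_space B fB,
        {ae mu, forall x, f x = xadd (fA x) (fB x)} & r = A fA + B fB]].

Definition embeds (X Y : (T -> xcomplex R) -> \bar R) : Prop :=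
  exists C : R, (0 <= C)%R /\ forall f, xmeasurable f -> Y f <= C%:E * X f.

Definition equivalent_norms (X Y : (T -> xcomplex R) -> \bar R) : Prop :=
  embeds X Y /\ embeds Y X.

End Functions.

Section HalfLine.
Context {R : realType}.

(* Functions on [0, oo) are represented by functions on the real line, the
   negative half-line being negligible for this measure. *)
Definition halfline_measure : set R -> \bar R :=
  mrestr lebesgue_measure (measurable_itv `[0%R : R, +oo[).

End HalfLine.

Section Amalgams.
Context {R : realType} {d : measure_display} {T : measurableType d}.
Variable mu : {measure set T -> \bar R}.
Implicit Types A B N : (T -> xcomplex R) -> \bar R.

Definition measure_preserving (s : T -> R) : Prop :=
  [/\ forall x, (0 <= s x)%R,
      measurable_fun [set: T] s &
      forall E, measurable E -> mu (s @^-1` E) = halfline_measure E].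

(* A chosen measure-preserving map onto the half-line measure space; one exists
   when [mu] is sigma-finite, non-atomic and infinite (the default value is
   irrelevant then). *)
Definition sigma_map : T -> R :=
  xget (fun=> 0%R) [set s | measure_preserving s].

Definition rep_norm N (g : R -> xcomplex R) : \bar R :=
  N (xlift (fun x => rearr halfline_measure g (sigma_map x))).

Definition local_part (h : R -> \bar R) : R -> xcomplex R :=
  xlift (h \_ `[0%R, 1%R]).

Definition global_part (h : R -> \bar R) : R -> xcomplex R :=
  xlift (h \_ `]1%R, +oo[).

Definition WL A B : (T -> xcomplex R) -> \bar R := fun f =>
  rep_norm A (local_part (rearr mu f)) + rep_norm B (global_part (rearr mu f)).

Definition local_stronger A B : Prop :=
  forall g : R -> xcomplex R, xmeasurable g ->
    rep_norm A (local_part (rearr halfline_measure g)) < +oo ->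
    rep_norm B (local_part (rearr halfline_measure g)) < +oo.

Definition global_stronger B A : Prop :=
  forall g : R -> xcomplex R, xmeasurable g ->
    rearr halfline_measure g 1%R < +oo ->
    rep_norm B (global_part (rearr halfline_measure g)) < +oo ->
    rep_norm A (global_part (rearr halfline_measure g)) < +oo.

End Amalgams.

(* Main.v *)
(* A measure-preserving map sigma onto the half-line comes from a maximal chain
   of sets of finite measure: since mu is non-atomic, the chain takes every
   value t >= 0, and sigma x is the least t whose member contains x.
   Consequently g^* o sigma has the quasinorm of g, and every quasinorm on the
   half-line can be computed on T.

   With c = f^*(1), cutting f along {|f| > c} gives WL(A,B) -> A + B: the part
   above c has rearrangement at most f^* on [0,1], the part below c has
   rearrangement at most f^*(max(t,1)), and c is controlled by the local part.
   The qualitative comparison of local (global) components becomes an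
   inequality by a gliding hump: badly behaved functions are summed using the
   quasi-triangle inequality and the Fatou property.

   For A + B -> WL(B,A), write g = |f_A| + |f_B| and c = g^*(1), which is at
   most f_A^*(1/2) + f_B^*(1/2).  The part of g on {g > c} lives on a set of
   measure at most 1, where |f_A| only matters through its local part, while
   in min(g,c) the function |f_B| only matters through its global part; no
   bound on dilations is needed. *)

Require Import Defs.
From HB Require Import structures.
From mathcomp Require Import all_boot all_order all_algebra.
From mathcomp Require Import complex.
From mathcomp Require Import all_classical all_reals all_analysis.
From mathcomp Require Import measurable_realfun.
From mathcomp Require Import ring lra.
Import Order.TTheory GRing.Theory Num.Theory.
Import numFieldNormedType.Exports.

Local Open Scope classical_set_scope.
Local Open Scope ring_scope.
Local Open Scope ereal_scope.

(** * Measure-preserving maps onto the half-line *)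

Section HalflineMeasure.
Variable R : realType.

Let halfline0 : @halfline_measure R set0 = 0.
Proof. by rewrite /halfline_measure /mrestr set0I measure0. Qed.

Let halfline_ge0 A : 0 <= @halfline_measure R A.
Proof. by rewrite /halfline_measure /mrestr measure_ge0. Qed.

Let halfline_sigma_additive : semi_sigma_additive (@halfline_measure R).
Proof.
exact: (@measure_semi_sigma_additive _ _ _
  (mrestr lebesgue_measure (measurable_itv `[0%R : R, +oo[))).
Qed.

HB.instance Definition _ := isMeasure.Build _ _ _ (@halfline_measure R)
  halfline0 halfline_ge0 halfline_sigma_additive.

(** Negative reals are negligible, so only t >= 0 matters; there [P] is the interval [0,m), whose
    length is m, finite or not. *)
Lemma halfline_initial (P : set R) (m : \bar R) : 0 <= m ->
  (forall t, (0 <= t)%R -> P t <-> t%:E < m) -> @halfline_measure R P = m.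
Proof.
move=> m0 Pm; rewrite /halfline_measure /mrestr.
case: m m0 Pm => [r| |]// r0 Pm.
- have -> : P `&` `[0%R, +oo[%classic = `[0%R, r[%classic.
    apply/seteqP; split=> t /=; rewrite !in_itv/= ?andbT.
      by move=> [Pt t0]; rewrite t0/= -lte_fin; exact/Pm.
    by move=> /andP[t0 tr]; split=> //; apply/Pm.
  rewrite lebesgue_measure_itv/= lte_fin sube0.
  by have [|] := ltP 0%R r => // r0'; congr _%:E; apply/le_anti; rewrite r0' -lee_fin r0.
- have -> : P `&` `[0%R, +oo[%classic = `[0%R, +oo[%classic.
    apply/seteqP; split=> t /=; rewrite !in_itv/= ?andbT; first by case.
    by move=> t0; split=> //; apply/Pm; rewrite ?ltry.
  by rewrite lebesgue_measure_itv/= ltry.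
Qed.

End HalflineMeasure.

Section MeasurePreservingMap.
Set Implicit Arguments.
Unset Strict Implicit.
Unset Printing Implicit Defensive.
Context {d : measure_display} {T : measurableType d} {R : realType}.
Variable mu : {measure set T -> \bar R}.

(** Partial unions of the sigma-finite cover have finite measures tending to infinity, so some
    subsequence gains at least 1 at each step. The gain makes it a chain in the sense of
    [measure_chain], with unbounded values. *)
Lemma exhaustion : sigma_finite [set: T] mu -> mu [set: T] = +oo ->
  exists B_ : nat -> set T,
    [/\ B_ 0%N = set0,
        forall n, measurable (B_ n) /\ mu (B_ n) < +oo,
        forall n, B_ n `<=` B_ n.+1,
        forall n, mu (B_ n) + 1 <= mu (B_ n.+1) &
        forall x, exists n, B_ n x].
Proof.
move=> [F TF Ffin] muT.
pose A n := \big[setU/set0]_(i < n) F i.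
have mA n : measurable (A n).
  by apply: bigsetU_measurable => i _; have [] := Ffin i.
have Afin n : mu (A n) < +oo.
  rewrite /A; elim: n => [|n IH]; first by rewrite big_ord0 measure0.
  rewrite big_ord_recr/= (@le_lt_trans _ _ (mu (A n) + mu (F n)))//.
    by apply: measureU2; [exact: mA|exact: (Ffin n).1].
  by apply: lte_add_pinfty => //; exact: (Ffin n).2.
have ndA : nondecreasing_seq A.
  by move=> m n mn; apply/subsetPset; exact: subset_bigsetU.
have UA : \bigcup_n A n = [set: T].
  apply/seteqP; split=> // x _; move: (I : [set: T] x); rewrite TF => -[n _ Fx].
  by exists n.+1 => //; rewrite /A big_ord_recr/=; right.
have cvA : (mu \o A) n @[n --> \oo] --> +oo.
  rewrite -muT -UA; apply: nondecreasing_cvg_mu => //.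
  by rewrite UA.
have step n : exists m, (n < m)%N /\ mu (A n) + 1 <= mu (A m).
  have : mu (A n) + 1 < +oo by apply: lte_add_pinfty => //; rewrite ltry.
  rewrite -ge0_fin_numE ?adde_ge0// => fn.
  have [N _ NP] : \forall m \near \oo, mu (A n) + 1 <= mu (A m).
    have /cvgeyPge/(_ (fine (mu (A n) + 1))) := cvA.
    by rewrite fineK.
  exists (maxn n.+1 N); split; first by rewrite leq_max ltnSn.
  by apply: NP; rewrite /= leq_max leqnn orbT.
have [f fP] := choice step.
pose k n := iter n f 0%N.
have kge n : (n <= k n)%N.
  by elim: n => // n IH; apply: leq_ltn_trans IH _; exact: (fP _).1.
exists (A \o k); split => [|n|n|n|x] /=.
- by rewrite /A big_ord0.
- by split; [exact: mA|exact: Afin].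
- by apply/subsetPset/ndA/ltnW; exact: (fP _).1.
- exact: (fP _).2.
- have [n _ Ax] : (\bigcup_n A n) x by rewrite UA.
  by exists n; move: x Ax; apply/subsetPset/ndA.
Qed.

(* The second clause also forces members of equal measure to coincide; a chain
   that is merely maximal for inclusion could grow through uncountably many
   null sets and skip values of the measure. *)
Definition measure_chain (M : set (set T)) :=
  (forall F, M F -> measurable F /\ mu F < +oo) /\
  (forall F G, M F -> M G -> mu F <= mu G -> F `<=` G).

Lemma maximal_measure_chain (C0 : set (set T)) : measure_chain C0 ->
  exists M, [/\ measure_chain M, C0 `<=` M &
    forall F, measurable F -> mu F < +oo ->
      (forall G, M G -> (mu F <= mu G -> F `<=` G) /\
                        (mu G <= mu F -> G `<=` F)) -> M F].
Proof.
(* Zorn is applied to the families that form a chain together with [C0]; the empty union is then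
   admissible. *)
move=> cC0; pose P C := measure_chain (C `|` C0).
have [|C [PC maxC]] := @Zorn_bigcup _ P.
  move=> FF FFP tFF; split=> [F [[X FX XF]|C0F]|F G].
  - by have [+ _] := FFP _ FX; apply; left.
  - exact: (cC0.1 _ C0F).
  - case=> [[X FX XF]|C0F] [[Y FY YG]|C0G].
    + have [XY|YX] := tFF _ _ FX FY.
      * by have [_] := FFP _ FY; apply; left => //; exact: XY.
      * by have [_] := FFP _ FX; apply; left => //; exact: YX.
    + by have [_] := FFP _ FX; apply; [left|right].
    + by have [_] := FFP _ FY; apply; [right|left].
    + by apply: cC0.2.
exists (C `|` C0); split => //.
move=> F mF Ffin FP; apply: contrapT => nF.
apply: (maxC (C `|` [set F])).
  split=> [|sub]; first by left.
  by apply: nF; left; apply: sub; right.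
have [PC1 PC2] := PC.
split=> [G [[CG|->//]|C0G]|G H].
- by apply: PC1; left.
- by apply: PC1; right.
- case=> [[CG| ->]|C0G] [[CH| ->]|C0H] //.
  + by apply: PC2; left.
  + by apply: (FP G _).2; left.
  + by apply: PC2; [left|right].
  + by apply: (FP H _).1; left.
  + by move=> _ x.
  + by apply: (FP H _).1; right.
  + by apply: PC2; [right|left].
  + by apply: (FP G _).2; right.
  + by apply: PC2; right.
Qed.

Lemma chain_mem M F : measure_chain M -> M F -> measurable F /\ mu F < +oo.
Proof. by move=> [+ _]; apply. Qed.

Lemma chain_sub M F G : measure_chain M -> M F -> M G -> mu F <= mu G ->
  F `<=` G.
Proof. by move=> [_ +]; apply. Qed.

Lemma measure_chain_total M F G : measure_chain M -> M F -> M G ->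
  F `<=` G \/ G `<=` F.
Proof.
move=> [_ cM] MF MG; have [FG|GF] := leP (mu F) (mu G); [left|right].
  exact: cM.
by apply: cM => //; exact: ltW.
Qed.

(** By totality each finite union is one of the [F m], so continuity from below carries the bound to
    the limit. *)
Lemma chain_bigcup M (F : nat -> set T) (t : \bar R) : measure_chain M ->
  (forall n, M (F n)) -> (forall n, mu (F n) <= t) ->
  mu (\bigcup_n F n) <= t.
Proof.
move=> cM MF Ft; pose G n := \big[setU/set0]_(i < n.+1) F i.
have MG n : exists m, G n = F m.
  rewrite /G; elim: n => [|n [m IH]]; first by exists 0%N; rewrite big_ord1.
  rewrite big_ord_recr/= IH.
  have [/setUidPr ->|/setUidPl ->] := measure_chain_total cM (MF m) (MF n.+1).
  - by exists n.+1.
  - by exists m.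
have mG n : measurable (G n).
  by have [m ->] := MG n; have [] := cM.1 _ (MF m).
have -> : \bigcup_n F n = \bigcup_n G n.
  apply/seteqP; split=> [x [n _ Fx]|x [n _]].
    by exists n => //; rewrite /G big_ord_recr/=; right.
  by have [m ->] := MG n; exists m.
have : (mu \o G) n @[n --> \oo] --> mu (\bigcup_n G n).
  apply: nondecreasing_cvg_mu => //; first exact: bigcup_measurable.
  by move=> m n mn; apply/subsetPset; apply: subset_bigsetU; rewrite ltnS.
move=> cvG; rewrite -(cvg_lim _ cvG)//.
apply: lime_le; first by apply/cvg_ex; eexists; exact: cvG.
by apply: nearW => n /=; have [m ->] := MG n.
Qed.

(** Finite intersections are again among the [F m]; members have finite measure, so continuity from
    above applies. *)
Lemma chain_bigcap M (F : nat -> set T) (t : \bar R) : measure_chain M ->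
  (forall n, M (F n)) -> (forall n, t <= mu (F n)) ->
  t <= mu (\bigcap_n F n).
Proof.
move=> cM MF Ft; pose G n := \big[setI/setT]_(i < n.+1) F i.
have MG n : exists m, G n = F m.
  rewrite /G; elim: n => [|n [m IH]]; first by exists 0%N; rewrite big_ord1.
  rewrite big_ord_recr/= IH.
  have [/setIidPl ->|/setIidPr ->] := measure_chain_total cM (MF m) (MF n.+1).
  - by exists m.
  - by exists n.+1.
have mG n : measurable (G n).
  by have [m ->] := MG n; have [] := cM.1 _ (MF m).
have -> : \bigcap_n F n = \bigcap_n G n.
  apply/seteqP; split=> [x Fx n _|x Gx n _].
    by have [m ->] := MG n; exact: Fx.
  by have := Gx n Logic.I; rewrite /G big_ord_recr/= => -[].
have : (mu \o G) n @[n --> \oo] --> mu (\bigcap_n G n).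
  apply: nonincreasing_cvg_mu => //.
  - by have [m ->] := MG 0%N; have [] := cM.1 _ (MF m).
  - exact: bigcap_measurableType.
  - move=> m n; rewrite -ltnS => mn; apply/subsetPset; rewrite /G -!bigcap_mkord.
    by move=> x Fx i /= im; apply: Fx; exact: leq_trans im mn.
move=> cvG; rewrite -(cvg_lim _ cvG)//.
apply: lime_ge; first by apply/cvg_ex; eexists; exact: cvG.
by apply: nearW => n /=; have [m ->] := MG n.
Qed.

(** * Intermediate values of the measure on a maximal chain *)

Section MaximalChain.
Variable M : set (set T).
Hypothesis chM : measure_chain M.
Hypothesis maxM : forall F, measurable F -> mu F < +oo ->
  (forall G, M G -> (mu F <= mu G -> F `<=` G) /\
                    (mu G <= mu F -> G `<=` F)) -> M F.

(* Members of M of equal measure coincide, so the measure of F is either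
   already taken or F is comparable with all of M. *)
Lemma chain_value F : measurable F -> mu F < +oo ->
  (forall G, M G -> mu G != mu F -> (mu F <= mu G -> F `<=` G) /\
                    (mu G <= mu F -> G `<=` F)) ->
  exists2 L, M L & mu L = mu F.
Proof.
move=> mF Ffin FP.
have [[L [ML LF]]|nL] := EM (exists L, M L /\ mu L = mu F); first by exists L.
exists F => //; apply: maxM => // G MG; apply: FP => //.
by apply/eqP => GF; apply: nL; exists G.
Qed.

(** The union of a maximizing sequence is comparable with every member of different measure, so by
    [chain_value] the supremum is attained in the chain. *)
Lemma chain_sup (t : R) : (exists2 G, M G & mu G <= t%:E) ->
  exists L, [/\ M L, mu L <= t%:E &
    forall G, M G -> mu G <= t%:E -> mu G <= mu L].
Proof.
move=> [G0 MG0 G0t].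
pose S := [set mu G | G in [set G | M G /\ mu G <= t%:E]].
have [|u uS cvu] := @ereal_sup_seq R S.
  by apply/set0P; exists (mu G0), G0.
have /choice[F FP] : forall n, exists G, (M G /\ mu G <= t%:E) /\ mu G = u n.
  by move=> n; have [G ? ?] := uS n; exists G.
have MF n : M (F n) by have [[]] := FP n.
have Ft n : mu (F n) <= t%:E by have [[]] := FP n.
have mU : measurable (\bigcup_n F n).
  by apply: bigcup_measurable => n _; exact: (chain_mem chM (MF n)).1.
have Ut : mu (\bigcup_n F n) <= t%:E by exact: chain_bigcup chM MF Ft.
have FU n : mu (F n) <= mu (\bigcup_n F n).
  apply: le_measure; rewrite ?inE//; first exact: (chain_mem chM (MF n)).1.
  exact: bigcup_sup.
have [|G MG neq|L ML LE] := chain_value mU.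
- by apply: le_lt_trans Ut _; rewrite ltry.
- split=> [UG x [n _ Fx]|GU].
    by have := chain_sub chM (MF n) MG (le_trans (FU n) UG); exact.
  have [[n GF]|nG] := EM (exists n, mu G <= mu (F n)).
    by apply: subset_trans (chain_sub chM MG (MF n) GF) _; exact: bigcup_sup.
  (* Here G exceeds every [F n] in measure, hence bounds the measure of their union; with [GU] the
     two measures agree, which [neq] excludes. *)
  exfalso; move/negP: neq; apply; rewrite eq_le GU/=.
  apply: (chain_bigcup chM MF) => n; rewrite leNgt; apply/negP => nF.
  by apply: nG; exists n; exact: ltW.
- exists L; split=> //; rewrite LE// => G MG Gt.
  apply: (@le_trans _ _ (ereal_sup S)).
    by apply: ereal_sup_ubound; exists G.
  rewrite -(cvg_lim _ cvu)//; apply: lime_le.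
    by apply/cvg_ex; eexists; exact: cvu.
  by apply: nearW => n /=; have [_ <-] := FP n; exact: FU.
Qed.

(** Dual of [chain_sup]: the intersection of a minimizing sequence plays the role of the union. *)
Lemma chain_inf (t : R) : (exists2 G, M G & t%:E <= mu G) ->
  exists U, [/\ M U, t%:E <= mu U &
    forall G, M G -> t%:E <= mu G -> mu U <= mu G].
Proof.
move=> [G0 MG0 G0t].
pose S := [set mu G | G in [set G | M G /\ t%:E <= mu G]].
have [|u uS cvu] := @ereal_inf_seq R S.
  by apply/set0P; exists (mu G0), G0.
have /choice[F FP] : forall n, exists G, (M G /\ t%:E <= mu G) /\ mu G = u n.
  by move=> n; have [G ? ?] := uS n; exists G.
have MF n : M (F n) by have [[]] := FP n.
have Ft n : t%:E <= mu (F n) by have [[]] := FP n.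
have mU : measurable (\bigcap_n F n).
  by apply: bigcap_measurableType => n _; exact: (chain_mem chM (MF n)).1.
have Ut : t%:E <= mu (\bigcap_n F n) by exact: chain_bigcap chM MF Ft.
have FU n : mu (\bigcap_n F n) <= mu (F n).
  apply: le_measure; rewrite ?inE//; first exact: (chain_mem chM (MF n)).1.
  exact: bigcap_inf.
have [|G MG neq|L ML LE] := chain_value mU.
- exact: le_lt_trans (FU 0%N) (chain_mem chM (MF 0%N)).2.
- split=> [UG|GU x Gx n _]; last first.
    by have := chain_sub chM MG (MF n) (le_trans GU (FU n)); exact.
  have [[n GF]|nG] := EM (exists n, mu (F n) <= mu G).
    by apply: subset_trans (chain_sub chM (MF n) MG GF); exact: bigcap_inf.
  exfalso; move/negP: neq; apply; rewrite eq_le UG andbT.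
  apply: (chain_bigcap chM MF) => n; rewrite leNgt; apply/negP => nF.
  by apply: nG; exists n; exact: ltW.
- exists L; split=> //; rewrite LE// => G MG Gt.
  apply: (@le_trans _ _ (ereal_inf S)); last first.
    by apply: ereal_inf_lbound; exists G.
  rewrite -(cvg_lim _ cvu)//; apply: lime_ge.
    by apply/cvg_ex; eexists; exact: cvu.
  by apply: nearW => n /=; have [_ <-] := FP n; exact: FU.
Qed.

(** Let L be the largest member below t and U the smallest above. If both miss t, then U minus L has
    positive measure and, not being an atom, contains some F of intermediate measure. The set L u F
    is comparable with all members, so maximality puts it in the chain, inside the gap. *)
Lemma chain_all_values (t : R) : non_atomic mu ->
  (exists2 G, M G & mu G <= t%:E) -> (exists2 G, M G & t%:E <= mu G) ->
  exists2 F, M F & mu F = t%:E.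
Proof.
move=> NA /chain_sup[L [ML Lt Lmax]] /chain_inf[U [MU tU Umin]].
have [<-|nLt] := eqVneq (mu L) t%:E; first by exists L.
have [<-|nUt] := eqVneq (mu U) t%:E; first by exists U.
have {}Lt : mu L < t%:E by rewrite lt_neqAle nLt.
have {}tU : t%:E < mu U by rewrite lt_neqAle eq_sym nUt.
have LU := chain_sub chM ML MU (ltW (lt_trans Lt tU)).
have [mL Lfin] := chain_mem chM ML; have [mU Ufin] := chain_mem chM MU.
have mD : measurable (U `\` L) by exact: measurableD.
have UE : mu U = mu L + mu (U `\` L).
  rewrite -measureU//; first by rewrite setDUK.
  by rewrite setDE setIC -setIA setICl setI0.
have finL : mu L \is a fin_num by rewrite ge0_fin_numE.
exfalso; apply: NA; exists (U `\` L); split=> //.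
  rewrite lt_neqAle measure_ge0 andbT eq_sym; apply/eqP => D0.
  by have := lt_trans Lt tU; rewrite UE D0 adde0 ltxx.
move=> F mF FD.
have [->|F0] := eqVneq (mu F) 0; first by left.
have [->|FDm] := eqVneq (mu F) (mu (U `\` L)); first by right.
exfalso.
have VE : mu (L `|` F) = mu L + mu F.
  apply: measureU => //; apply/seteqP; split=> // x [Lx /FD[_]]; exact.
have LV : mu L < mu (L `|` F).
  by rewrite VE lteDl// lt_neqAle eq_sym F0 measure_ge0.
have VU : mu (L `|` F) < mu U.
  rewrite VE UE lteD2lE// lt_neqAle FDm/=.
  by apply: le_measure; rewrite ?inE.
have MV : M (L `|` F).
  apply: maxM; [exact: measurableU|exact: lt_trans VU Ufin|move=> G MG].
  have [GL|UG] : mu G <= mu L \/ mu U <= mu G.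
    have [Gt|tG] := leP (mu G) t%:E; [left; exact: Lmax|right].
    by apply: Umin => //; exact: ltW.
  - split=> [VG|_ x Gx]; first by have := lt_le_trans LV (le_trans VG GL); rewrite ltxx.
    by left; apply: (chain_sub chM MG ML).
  - split=> [_|GV]; last by have := lt_le_trans VU (le_trans UG GV); rewrite ltxx.
    apply: subset_trans (chain_sub chM MU MG UG) => x [/LU//|/FD[]//].
have [Vt|tV] := leP (mu (L `|` F)) t%:E.
  by have := lt_le_trans LV (Lmax _ MV Vt); rewrite ltxx.
by have := lt_le_trans VU (Umin _ MV (ltW tV)); rewrite ltxx.
Qed.

End MaximalChain.

(** A maximal chain containing the exhaustion has members below and above every t >= 0, hence takes
    every value. A point of [B n] lies in the level of measure mu (B n), since equal measures force
    inclusion. *)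
Lemma level_chain : sigma_finite [set: T] mu -> mu [set: T] = +oo ->
  non_atomic mu -> exists F : R -> set T,
    [/\ forall t, (0 <= t)%R -> measurable (F t) /\ mu (F t) = t%:E,
        forall s t, (0 <= s)%R -> (s <= t)%R -> F s `<=` F t &
        forall x, exists2 t, (0 <= t)%R & F t x].
Proof.
move=> sf muT NA; have [B [B0 Bm ndB Bstep Bcov]] := exhaustion sf muT.
have Bmono m n : (m <= n)%N -> B m `<=` B n.
  elim: n => [|n IH]; first by rewrite leqn0 => /eqP ->.
  rewrite leq_eqVlt ltnS => /predU1P[->//|/IH]; move/subset_trans; apply.
  exact: ndB.
have Bgrow m n : (m < n)%N -> mu (B m) < mu (B n).
  move=> mn; apply: (@lt_le_trans _ _ (mu (B m) + 1)).
    by rewrite lteDl ?lte01// ge0_fin_numE//; exact: (Bm m).2.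
  apply: le_trans (Bstep m) _.
  by apply: le_measure; rewrite ?inE; [exact: (Bm _).1|exact: (Bm _).1|exact: Bmono].
have Bge n : n%:R%:E <= mu (B n).
  elim: n => [|n IH]; first by rewrite measure_ge0.
  by apply: le_trans (Bstep n); rewrite -natr1 EFinD leeD2r.
have chB : measure_chain (range B).
  split=> [_ [n _ <-]//|_ _ [m _ <-] [n _ <-] mn]; apply: Bmono.
  by rewrite leqNgt; apply/negP => /Bgrow; rewrite ltNge mn.
have [M [chM BM maxM]] := maximal_measure_chain chB.
have val t : exists F, (0 <= t)%R -> M F /\ mu F = t%:E.
  have [t0|] := boolP (0 <= t)%R; last by exists set0.
  have [||F MF Ft] := @chain_all_values M chM maxM t NA.
  - by exists (B 0%N); [apply: BM; exists 0%N|rewrite B0 measure0 lee_fin].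
  - exists (B (Num.truncn t).+1); first by apply: BM; exists (Num.truncn t).+1.
    by apply: le_trans (Bge _); rewrite lee_fin ltW// truncnS_gt.
  - by exists F.
have [F FP] := choice val; exists F; split=> [t t0|s t s0 st|x].
- by have [MF ->] := FP t t0; split=> //; exact: (chain_mem chM MF).1.
- have [MFs sE] := FP s s0; have [MFt tE] := FP t (le_trans s0 st).
  by apply: (chain_sub chM) => //; rewrite sE tE lee_fin.
- have [n Bx] := Bcov x; pose t := fine (mu (B n)).
  have t0 : (0 <= t)%R by exact: fine_ge0.
  have [MF FE] := FP t t0; exists t => //.
  apply: (chain_sub chM _ MF _ Bx); first by apply: BM; exists n.
  by rewrite FE /t fineK// ge0_fin_numE//; exact: (Bm n).2.
Qed.

Lemma measure_preserving_exists : sigma_finite [set: T] mu ->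
  mu [set: T] = +oo -> non_atomic mu -> exists s, measure_preserving mu s.
Proof.
move=> sf muT NA; have [F [Fm ndF Fcov]] := level_chain sf muT NA.
pose S x := [set t : R | (0 <= t)%R /\ F t x].
have S0 x : S x !=set0 by have [t t0 Ft] := Fcov x; exists t.
have Slb x : lbound (S x) 0%R by move=> t [].
pose s x := inf (S x).
have slt x t : (s x < t)%R <-> exists r, [/\ (0 <= r)%R, (r < t)%R & F r x].
  split=> [/(inf_lt (S0 x))[r [r0 Fr] rt]|[r [r0 rt Fr]]]; first by exists r.
  by apply: le_lt_trans rt; apply: ge_inf; [exists 0%R|].
have s0 x : (0 <= s x)%R by exact: lb_le_inf.
(* The infimum defining [s x] need not be attained, but the strict sublevel set is a countable union
   of levels at rationals below t, which gives measurability. *)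
have preE t : s @^-1` `]-oo, t[%classic =
    \bigcup_(q in [set q : rat | (0 <= ratr q :> R)%R /\ (ratr q < t)%R]) F (ratr q).
  apply/seteqP; split=> [x|x [q [q0 qt] Fq]] /=; rewrite in_itv/=.
    move=> /slt[r [r0 rt Fr]]; have [q] := rat_in_itvoo rt.
    rewrite in_itv/= => /andP[rq qt]; have q0 := ltW (le_lt_trans r0 rq).
    by exists q; [split|exact: (ndF _ _ r0 (ltW rq) _ Fr)].
  by apply/slt; exists (ratr q).
have mpre t : measurable (s @^-1` `]-oo, t[%classic).
  rewrite preE bigcup_mkcond; apply: bigcupT_measurable_rat => q.
  by case: ifPn => // /set_mem[q0 _]; exact: (Fm _ q0).1.
have ms : measurable_fun [set: T] s.
  apply: (measurability _ (RGenInftyO.measurableE R)) => //.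
  by move=> _ [_ [t ->] <-]; rewrite setTI.
have mupre t : mu (s @^-1` `]-oo, t[%classic) = (Num.max t 0)%:E.
  have [t0|t0] := leP t 0%R.
    rewrite (_ : _ @^-1` _ = set0) ?measure0//.
    apply/seteqP; split=> // x /=; rewrite in_itv/= => /lt_le_trans/(_ t0).
    by rewrite ltNge s0.
  apply/eqP; rewrite eq_le; apply/andP; split.
    have [mFt <-] := Fm _ (ltW t0); apply: le_measure; rewrite ?inE//.
    move=> x /=; rewrite in_itv/= => /slt[r [r0 rt Fr]].
    by apply: ndF Fr => //; exact: ltW.
  (* The level at t - e lies in the sublevel set for every e > 0, which gives the lower bound in the
     limit. *)
  apply/lee_subgt0Pr => e e0.
  have [te|te] := leP (t - e)%R 0%R.
    by apply: (@le_trans _ _ 0); rewrite ?measure_ge0// -EFinB lee_fin.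
  rewrite -EFinB; have [mF <-] := Fm _ (ltW te); apply: le_measure; rewrite ?inE//.
  move=> x Fx /=; rewrite in_itv/=; apply/slt; exists (t - e)%R; split=> //.
    exact: ltW.
  by rewrite ltrBlDr ltrDl.
have [nu nuE] : exists nu : {measure set R -> \bar R},
    forall A, nu A = mu (s @^-1` A).
  by exists (measure_function_pushforward__canonical__measure_function_Measure mu ms).
exists s; split=> // E mE; rewrite -nuE.
(* The pushforward and the half-line measure are compared on the open left rays, a pi-system
   generating the Borel sets on which both are finite. *)
apply: (measure_unique [set A | exists x : R, A = `]-oo, x[%classic]
  (fun n => `]-oo, n%:R[%classic)
  _ _ _ _ nu (@halfline_measure R)).
- exact: RGenInftyO.measurableE.
- move=> _ _ [x ->] [y ->]; exists (Num.min x y).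
  apply/seteqP; split=> z /=; rewrite !in_itv/= lt_min.
    by move=> [-> ->].
  by move=> /andP[].
- by move=> n; exists n%:R.
- apply/seteqP; split=> // x _; exists (Num.truncn x).+1 => //=.
  by rewrite in_itv/= truncnS_gt.
- move=> _ [x ->]; rewrite nuE mupre; apply/esym/halfline_initial.
    by rewrite lee_fin le_max lexx orbT.
  by move=> u u0; rewrite /= in_itv/= lte_fin lt_max ltNge orbC ltNge u0.
- by move=> k; rewrite nuE mupre ltry.
- exact: mE.
Qed.

End MeasurePreservingMap.

(** * Rearrangements *)

Section Modulus.
Set Implicit Arguments.
Unset Strict Implicit.
Unset Printing Implicit Defensive.
Context {R : realType}.

Lemma xmod_ge0 (z : xcomplex R) : 0 <= xmod z.
Proof.
by case: z => [[a b]|] //=; rewrite lee_fin sqrtr_ge0.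
Qed.

Lemma xmod_xof (r : \bar R) : 0 <= r -> xmod (xof r) = r.
Proof.
case: r => [r| |]//=; rewrite lee_fin => r0.
by rewrite expr0n/= addr0 sqrtr_sqr ger0_norm.
Qed.

Lemma modulus_ge0 {T : Type} (f : T -> xcomplex R) x : 0 <= modulus f x.
Proof. exact: xmod_ge0. Qed.

Context {d : measure_display} {T : measurableType d}.
Implicit Types (f : T -> xcomplex R) (h : T -> \bar R).

Lemma xmeasurable_xlift h : nonneg_measurable h -> xmeasurable (xlift h).
Proof.
move=> [mh h0]; split.
  rewrite (_ : (fun x => _) = h)//; apply/funext => x.
  by rewrite /xlift; case: (h x) (h0 x).
rewrite (_ : (fun x => _) = (fun x => if +oo <= h x then +oo else 0)).
  apply: measurable_fun_ifT => //; exact: measurable_fun_lee.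
apply/funext => x; rewrite /xlift leye_eq.
by case: (h x) (h0 x).
Qed.

Lemma measurable_modulus f : xmeasurable f -> nonneg_measurable (modulus f).
Proof.
move=> [mRe mIm]; split; last exact: modulus_ge0.
rewrite (_ : modulus f = (fun x => if +oo <= xRe (f x) then +oo else
  (Num.sqrt (fine (xRe (f x)) ^+ 2 + fine (xIm (f x)) ^+ 2))%:E)); last first.
  apply/funext => x; rewrite /modulus leye_eq.
  by case: (f x) => [[a b]|].
apply: measurable_fun_ifT => //; first exact: measurable_fun_lee.
apply/measurable_EFinP.
apply: (@measurableT_comp _ _ _ _ _ _ (@Num.sqrt R)).
  by apply: continuous_measurable_fun; exact: sqrt_continuous.
by apply: measurable_funD; apply: measurable_funX;
   apply: measurableT_comp => //; exact: fine_measurable.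
Qed.

End Modulus.

Section RearrangementTheory.
Set Implicit Arguments.
Unset Strict Implicit.
Unset Printing Implicit Defensive.

(** Testing on real levels reduces comparisons of rearrangements to comparisons of distribution
    functions, whose levels are real. *)
Lemma le_of_lt_real (R : realType) (x y : \bar R) : 0 <= y ->
  (forall s : R, (0 <= s)%R -> s%:E < x -> s%:E <= y) -> x <= y.
Proof.
move=> y0 xy; rewrite leNgt; apply/negP.
case: y y0 xy => [y| |]//; last by move=> _ _; apply/negP; rewrite -leNgt leey.
rewrite lee_fin => y0 xy yx.
have [s ys sx] : exists2 s, (y < s)%R & s%:E < x.
  case: x yx {xy} => [x| |]//=; last by exists (y + 1)%R; rewrite ?ltrDl// ltry.
  by rewrite lte_fin => yx; exists ((y + x) / 2)%R; rewrite ?lte_fin midf_lt.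
by have := xy s (le_trans y0 (ltW ys)) sx; rewrite lee_fin leNgt ys.
Qed.

(** A rearrangement depends only on the modulus, so the theory is developed for functions with
    values in [0, oo]. *)
Definition nir {R : realType} {T : Type} (mu : set T -> \bar R)
  (h : T -> \bar R) : R -> \bar R := rearr mu (xlift h).

Lemma nirE {R : realType} {T : Type} (mu : set T -> \bar R) h t :
  (forall x, 0 <= h x) -> nir mu h t = ereal_inf [set s%:E | s in
    [set s : R | (0 <= s)%R /\ mu [set x | s%:E < h x] <= t%:E]].
Proof.
move=> h0; rewrite /nir /rearr /xlift.
suff E s : [set x | s%:E < xmod (xof (h x))] = [set x | s%:E < h x].
  by congr ereal_inf; apply/seteqP; split=> _ [s + <-];
    rewrite /= ?E => ?; exists s => //=; rewrite E.
by apply/seteqP; split=> x /=; rewrite xmod_xof.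
Qed.

Lemma rearrE {R : realType} {T : Type} (mu : set T -> \bar R)
  (f : T -> xcomplex R) : rearr mu f = nir mu (modulus f).
Proof.
by apply/funext => t; rewrite nirE//; exact: modulus_ge0.
Qed.

Context {R : realType}.

(** Monotonicity is imposed on the whole line; rearrangements satisfy it, being +oo at negative
    arguments. *)
Definition decreasing_nonneg (phi : R -> \bar R) :=
  (forall t, 0 <= phi t) /\ (forall t u, (t <= u)%R -> phi u <= phi t).

Lemma measurable_decreasing (phi : R -> \bar R) : decreasing_nonneg phi ->
  nonneg_measurable phi.
Proof.
move=> [phi0 dphi]; split=> //.
apply: (measurability _ (ErealGenOInfty.measurableE R)) => //.
move=> _ [_ [x ->] <-]; rewrite setTI; apply: is_interval_measurable.
move=> a b /= _; rewrite !in_itv/= !andbT => xb c /andP[_ cb].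
by rewrite in_itv/= andbT; exact: lt_le_trans (dphi _ _ cb).
Qed.

(** * Rearrangements and distribution functions *)

Section Basics.
Context {d : measure_display} {T : measurableType d}.
Variable mu : {measure set T -> \bar R}.
Implicit Types h : T -> \bar R.

Lemma nir_ge0 h t : 0 <= nir mu h t.
Proof. by apply: le_ereal_inf_tmp => _ [s [s0 _] <-]; rewrite lee_fin. Qed.

Lemma nir_neg h t : (t < 0)%R -> nir mu h t = +oo.
Proof.
move=> t0; rewrite /nir /rearr (_ : [set s%:E | s in _] = set0) ?ereal_inf0//.
apply/seteqP; split=> // _ [s [_ /=]] + _.
by apply/negP; rewrite -ltNge; apply: lt_le_trans (measure_ge0 _ _); rewrite lte_fin.
Qed.

Lemma nir_nonincreasing h t u : (t <= u)%R -> nir mu h u <= nir mu h t.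
Proof.
move=> tu; apply: ereal_inf_le_tmp => _ [s [s0 hs] <-]; exists s => //.
by split=> //; apply: le_trans hs _; rewrite lee_fin.
Qed.

Lemma measurable_above h (s : \bar R) : nonneg_measurable h ->
  measurable [set x | s < h x].
Proof.
move=> [mh _]; rewrite -[X in measurable X]setTI.
exact: emeasurable_fun_o_infty.
Qed.

(** The infimum defining the rearrangement is attained: {h > s} is the increasing union of the sets
    {h > s + 1/(n+1)}, so a bound t on their measures passes to {h > s}. *)
Lemma lt_nir h s t : nonneg_measurable h -> (0 <= s)%R -> (0 <= t)%R ->
  (s%:E < nir mu h t) = (t%:E < mu [set x | s%:E < h x]).
Proof.
move=> mh s0 t0; rewrite nirE; last exact: mh.2.
rewrite !ltNge; congr negb; apply/idP/idP => [hs|hs]; last first.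
  by apply: ereal_inf_lbound; exists s.
pose E n := [set x | (s + n.+1%:R^-1)%:E < h x].
have mE n : measurable (E n) by exact: measurable_above.
have -> : [set x | s%:E < h x] = \bigcup_n E n.
  apply/seteqP; split=> [x /= sx|x [n _]]; last first.
    by rewrite /E/=; apply: lt_trans; rewrite lte_fin ltrDl.
  have [k sk] : exists k, (s + k.+1%:R^-1)%:E < h x.
    case: (h x) sx => [r| |//]; last by exists 0%N; rewrite ltry.
    by rewrite lte_fin => /ltr_add_invr[k ?]; exists k; rewrite lte_fin.
  by exists k.
have Et n : mu (E n) <= t%:E.
  have /ereal_inf_lt[_ [r [r0 hr] <-]] : ereal_inf [set s%:E | s in
      [set s : R | (0 <= s)%R /\ mu [set x | s%:E < h x] <= t%:E]]
      < (s + n.+1%:R^-1)%:E.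
    by apply: le_lt_trans hs _; rewrite lte_fin ltrDl.
  rewrite lte_fin => rs; apply: le_trans hr.
  apply: le_measure; rewrite ?inE//; first exact: measurable_above.
  by move=> x; rewrite /E/=; apply: lt_trans; rewrite lte_fin.
have : (mu \o E) n @[n --> \oo] --> mu (\bigcup_n E n).
  apply: nondecreasing_cvg_mu => //; first exact: bigcup_measurable.
  move=> m n mn; apply/subsetPset => x; rewrite /E/=; apply: le_lt_trans.
  by rewrite lee_fin lerD2l lef_pV2 ?posrE// ler_nat.
move=> cvE; rewrite -(cvg_lim _ cvE)//; apply: lime_le.
  by apply/cvg_ex; eexists; exact: cvE.
exact: nearW.
Qed.

Lemma nir_le_real h s t : nonneg_measurable h -> (0 <= s)%R -> (0 <= t)%R ->
  (nir mu h t <= s%:E) = (mu [set x | s%:E < h x] <= t%:E).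
Proof. by move=> mh s0 t0; rewrite !leNgt lt_nir. Qed.

Lemma le_nir g h t : nonneg_measurable g -> nonneg_measurable h ->
  {ae mu, forall x, g x <= h x} -> nir mu g t <= nir mu h t.
Proof.
move=> mg mh [N [mN N0 gh]].
rewrite !nirE; [|exact: mh.2|exact: mg.2].
apply: ereal_inf_le_tmp => _ [s [s0 hs] <-]; exists s => //; split=> //.
apply: le_trans hs; rewrite -[leRHS]adde0 -N0.
apply: (@le_trans _ _ (mu ([set x | s%:E < h x] `|` N))); last first.
  by apply: measureU2 => //; exact: measurable_above.
apply: le_measure; rewrite ?inE//; first exact: measurable_above.
  by apply: measurableU => //; exact: measurable_above.
move=> x /= sg; have [gx|gx] := pselect (g x <= h x); last by right; exact: gh.
by left; exact: lt_le_trans gx.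
Qed.

Lemma decreasing_nir h : decreasing_nonneg (nir mu h).
Proof. by split=> [t|t u]; [exact: nir_ge0|exact: nir_nonincreasing]. Qed.

Lemma nonneg_measurable_nir h : nonneg_measurable (nir mu h).
Proof. exact/measurable_decreasing/decreasing_nir. Qed.

End Basics.

Lemma eq_nir {d d' : measure_display} {T : measurableType d}
  {T' : measurableType d'} (mu : {measure set T -> \bar R})
  (nu : {measure set T' -> \bar R}) (g : T' -> \bar R) (h : T -> \bar R) :
  nonneg_measurable g -> nonneg_measurable h ->
  (forall s : R, (0 <= s)%R ->
     nu [set x | s%:E < g x] = mu [set x | s%:E < h x]) ->
  nir nu g = nir mu h.
Proof.
move=> mg mh E; apply/funext => t; have [t0|t0] := ltP t 0%R.
  by rewrite !nir_neg.
apply/eqP; rewrite eq_le; apply/andP; split; apply: le_of_lt_real;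
  rewrite ?nir_ge0// => s s0.
  by rewrite lt_nir// E// -lt_nir// => /ltW.
by rewrite lt_nir// -E// -lt_nir// => /ltW.
Qed.

(** * Equimeasurability of a function, its rearrangement and its transport to the base space *)

Section Equimeasurability.
Context {d : measure_display} {T : measurableType d}.
Variable mu : {measure set T -> \bar R}.
Implicit Types h : T -> \bar R.

(** By [lt_nir] the superlevel set of the rearrangement is an initial segment of length mu {h >
    s}. *)
Lemma halfline_nir h s : nonneg_measurable h -> (0 <= s)%R ->
  halfline_measure [set t | s%:E < nir mu h t] = mu [set x | s%:E < h x].
Proof.
move=> mh s0; apply: halfline_initial => // t t0 /=.
by rewrite lt_nir.
Qed.

Lemma nir_nir h : nonneg_measurable h ->
  nir halfline_measure (nir mu h) = nir mu h.
Proof.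
move=> mh; apply: eq_nir => // [|s s0]; first exact: nonneg_measurable_nir.
exact: halfline_nir.
Qed.

Lemma nonneg_measurable_comp s (phi : R -> \bar R) : measure_preserving mu s ->
  nonneg_measurable phi -> nonneg_measurable (phi \o s).
Proof.
by move=> [_ ms _] [mphi phi0]; split=> [|x]; [exact: measurableT_comp|exact: phi0].
Qed.

Lemma nir_comp s (phi : R -> \bar R) : measure_preserving mu s -> nonneg_measurable phi ->
  nir mu (phi \o s) = nir halfline_measure phi.
Proof.
move=> ms mphi; apply: eq_nir => // [|u u0]; first exact: nonneg_measurable_comp.
case: ms => _ _; apply; exact: measurable_above.
Qed.

End Equimeasurability.
End RearrangementTheory.

(** * Rearrangement-invariant quasinorms *)

Section QuasiNorm.
Set Implicit Arguments.
Unset Strict Implicit.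
Unset Printing Implicit Defensive.
Context {R : realType} {d : measure_display} {T : measurableType d}.
Variable mu : {measure set T -> \bar R}.
Implicit Types (f : T -> xcomplex R) (g h : T -> \bar R).

Lemma xscale_xof (c : R) (r : \bar R) : (0 <= c)%R -> 0 <= r ->
  xscale (c%:C)%C (xof r) = xof (c%:E * r).
Proof.
move=> c0; case: r => [r| |]//= r0.
  by congr Some; apply/eqP; rewrite eq_complex/=; apply/andP; split;
    apply/eqP; ring.
rewrite eq_complex/= eqxx andbT; have [->|cn0] := eqVneq c 0%R.
  by rewrite mul0e.
by rewrite gt0_muley ?lte_fin ?lt_neqAle 1?eq_sym ?cn0.
Qed.

Section OneNorm.
Variable N : (T -> xcomplex R) -> \bar R.
Hypothesis HN : ri_quasi_norm mu N.

Lemma norm_ge0 h : nonneg_measurable h -> 0 <= N (xlift h).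
Proof. by move=> mh; apply: (rqn_ge0 HN); exact: xmeasurable_xlift. Qed.

Lemma le_norm g h : nonneg_measurable g -> nonneg_measurable h ->
  (forall x, g x <= h x) -> N (xlift g) <= N (xlift h).
Proof. by move=> mg mh gh; apply: (rqn_lattice HN) => //; exact: aeW. Qed.

Lemma norm0 : N (xlift (fun=> 0)) = 0.
Proof. by apply/(rqn_eq0 HN); [split|exact: aeW]. Qed.

Lemma normZ (c : R) h : (0 <= c)%R -> nonneg_measurable h ->
  N (xlift (fun x => c%:E * h x)) = c%:E * N (xlift h).
Proof.
move=> c0 mh.
rewrite (_ : xlift _ = fun x => xscale (c%:C)%C (xlift h x)); last first.
  by apply/funext => x; rewrite /xlift xscale_xof//; exact: mh.2.
by rewrite (rqn_scale HN)//= expr0n/= addr0 sqrtr_sqr ger0_norm.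
Qed.

Lemma eq_norm_nir g h : nonneg_measurable g -> nonneg_measurable h ->
  nir mu g = nir mu h -> N (xlift g) = N (xlift h).
Proof.
move=> mg mh gh; apply: (rqn_ri HN) => [||t _]; [exact: xmeasurable_xlift..|].
by rewrite -/(nir mu g) gh.
Qed.

(** Both functions have the same rearrangement. Any h may thus be replaced by a nonincreasing
    function of [s x], where pointwise comparisons are possible. *)
Lemma norm_nir s h : measure_preserving mu s -> nonneg_measurable h ->
  N (xlift (nir mu h \o s)) = N (xlift h).
Proof.
move=> ms mh; apply: eq_norm_nir => //.
  by apply: (nonneg_measurable_comp ms); exact: nonneg_measurable_nir.
by rewrite nir_comp ?nir_nir//; exact: nonneg_measurable_nir.
Qed.

Lemma rep_norm_xlift phi : measure_preserving mu (sigma_map mu) ->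
  nonneg_measurable phi ->
  rep_norm mu N (xlift phi) = N (xlift (phi \o sigma_map mu)).
Proof.
move=> ms mphi.
have mn : nonneg_measurable (nir (@halfline_measure R) phi).
  exact: nonneg_measurable_nir.
apply: eq_norm_nir; [exact: (nonneg_measurable_comp ms)..|].
by rewrite !nir_comp// nir_nir.
Qed.

(** The function h dominates c times the indicator of E, whose quasinorm is positive and finite; C
    is the inverse of that quasinorm. *)
Lemma level_bound E : measurable E -> 0 < mu E -> mu E < +oo ->
  exists C : R, (0 <= C)%R /\ forall (c : \bar R) h, 0 <= c ->
    nonneg_measurable h -> (forall x, E x -> c <= h x) ->
    c <= C%:E * N (xlift h).
Proof.
move=> mE E0 Efin; pose chi : T -> \bar R := fun x => (\1_E x)%:E.
have mchi : nonneg_measurable chi.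
  by split=> [|x]; [exact/measurable_EFinP/measurable_indic|rewrite lee_fin].
have chi0 : 0 < N (xlift chi).
  rewrite lt_neqAle norm_ge0// andbT; apply/eqP => /esym/(rqn_eq0 HN mchi).
  move=> [Z [mZ Z0 EZ]]; move: E0; rewrite ltNge; apply/negP.
  rewrite negbK -Z0; apply: le_measure; rewrite ?inE// => x Ex.
  apply: EZ; rewrite /= /chi indicE mem_set// => -[]; apply/eqP.
  by rewrite oner_eq0.
have chifin : N (xlift chi) \is a fin_num.
  by rewrite ge0_fin_numE ?norm_ge0//; exact: (rqn_indic HN).
set n0 := fine (N (xlift chi)).
have n00 : (0 < n0)%R by rewrite fine_gt0// chi0 -ge0_fin_numE ?norm_ge0.
exists n0^-1%R; split=> [|c h c0 mh ch]; first by rewrite invr_ge0 ltW.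
(* The level c may be infinite, so the bound is proved for each real r below it. *)
apply: le_of_lt_real => [|r r0 rc].
  by rewrite mule_ge0 ?norm_ge0// lee_fin invr_ge0 ltW.
rewrite lee_pdivlMl// muleC -[n0]/(fine _) fineK// -normZ//.
apply: le_norm => // [|x].
  split=> [|x]; first by apply: measurable_funeM; exact: mchi.1.
  by rewrite mule_ge0 ?lee_fin//; exact: mchi.2.
rewrite /chi indicE; have [/set_mem xE|_] := boolP (x \in E).
  by rewrite mule1; exact: le_trans (ltW rc) (ch x xE).
by rewrite mule0; exact: mh.2.
Qed.

(** * Series in a quasinorm *)

Section Series.
Variable K : R.
Hypothesis K1 : (1 <= K)%R.
Hypothesis triK : forall g h, nonneg_measurable g -> nonneg_measurable h ->
  N (xlift (g \+ h)) <= K%:E * (N (xlift g) + N (xlift h)).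

Lemma nonneg_measurable_sum (h_ : nat -> T -> \bar R) n :
  (forall i, nonneg_measurable (h_ i)) ->
  nonneg_measurable (fun x => \sum_(0 <= i < n) h_ i x).
Proof.
move=> mh; split=> [|x]; first by apply: emeasurable_sum => i; exact: (mh i).1.
by apply: sume_ge0 => i _; exact: (mh i).2.
Qed.

(** Split off the first term and apply the induction hypothesis to the shifted sequence with a/(2K)
    in place of a: the quasi-triangle inequality gives K (a/(2K) + a/(2K)) = a. *)
Lemma norm_partial_sum n (h_ : nat -> T -> \bar R) (a : R) : (0 <= a)%R ->
  (forall i, nonneg_measurable (h_ i)) ->
  (forall i, N (xlift (h_ i)) <= (a / (2 * K) ^+ i.+1)%:E) ->
  N (xlift (fun x => \sum_(0 <= i < n) h_ i x)) <= a%:E.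
Proof.
have K0 : (0 < K)%R by exact: lt_le_trans K1.
elim: n h_ a => [|n IH] h_ a a0 mh ha.
  rewrite (_ : xlift _ = xlift (fun=> 0)) ?norm0 ?lee_fin//.
  by apply/funext => x; rewrite /xlift big_nil.
rewrite (_ : xlift _ =
    xlift (h_ 0%N \+ (fun x => \sum_(0 <= i < n) h_ i.+1 x))); last first.
  by apply/funext => x; rewrite /xlift big_nat_recl.
apply: le_trans (triK (mh _) _) _; first exact: nonneg_measurable_sum.
apply: (@le_trans _ _ (K%:E * ((a / (2 * K))%:E + (a / (2 * K))%:E))).
  apply: lee_wpmul2l; first by rewrite lee_fin ltW.
  apply: leeD; first by have := ha 0%N; rewrite expr1.
  apply: IH => [|i|i]; first by rewrite divr_ge0// mulr_ge0// ltW.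
  - exact: mh.
  - apply: le_trans (ha i.+1) _; rewrite lee_fin -mulrA -invfM -exprS.
    exact: lexx.
rewrite -EFinD -EFinM lee_fin.
rewrite (_ : (K * _)%R = a)//; field; exact: lt0r_neq0.
Qed.

Lemma nonneg_measurable_series (h_ : nat -> T -> \bar R) :
  (forall i, nonneg_measurable (h_ i)) ->
  nonneg_measurable (fun x => \sum_(0 <= i <oo) h_ i x).
Proof.
move=> mh; split=> [|x].
  by apply: ge0_emeasurable_sum => // i *; [exact: (mh i).2|exact: (mh i).1].
by apply: nneseries_ge0 => i _ _; exact: (mh i).2.
Qed.

(** Partial sums increase to the series, so the Fatou property carries their uniform bound over. *)
Lemma norm_series (h_ : nat -> T -> \bar R) (a : R) : (0 <= a)%R ->
  (forall i, nonneg_measurable (h_ i)) ->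
  (forall i, N (xlift (h_ i)) <= (a / (2 * K) ^+ i.+1)%:E) ->
  N (xlift (fun x => \sum_(0 <= i <oo) h_ i x)) <= a%:E.
Proof.
move=> a0 mh ha.
have [|||_ cv] := @rqn_fatou _ _ _ _ _ HN
    (fun n x => \sum_(0 <= i < n) h_ i x) (fun x => \sum_(0 <= i <oo) h_ i x).
- by move=> n; exact: nonneg_measurable_sum.
- exact: nonneg_measurable_series.
- apply: aeW => x; split.
    by apply: ereal_nondecreasing_series => i _ _; exact: (mh i).2.
  by apply: is_cvg_nneseries => i _ _; exact: (mh i).2.
rewrite -(cvg_lim _ cv)//; apply: lime_le.
  by apply/cvg_ex; eexists; exact: cv.
by apply: nearW => n; exact: norm_partial_sum.
Qed.

End Series.
End OneNorm.

(** A common form for local and global parts: [p] selects where the function lives, [tau] where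
    [phi] is read. It is monotone and additive in [phi], so series of profiles can be summed. *)
Definition sample (p : T -> bool) (tau : T -> R) (phi : R -> \bar R) :
  T -> \bar R := fun x => if p x then phi (tau x) else 0.

Lemma measurable_sample p tau phi : measurable_fun [set: T] p ->
  measurable_fun [set: T] tau -> decreasing_nonneg phi ->
  nonneg_measurable (sample p tau phi).
Proof.
move=> mp mtau /measurable_decreasing[mphi phi0]; split=> [|x].
  by apply: measurable_fun_ifT => //; exact: measurableT_comp.
by rewrite /sample; case: ifP.
Qed.

Lemma nirZ (c : R) (phi : R -> \bar R) : (0 < c)%R -> nonneg_measurable phi ->
  nir halfline_measure (fun t => c%:E * phi t) =
  (fun t => c%:E * nir halfline_measure phi t).
Proof.
move=> c0 mphi; have [phim phi0] := mphi; apply/funext => t.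
have mc : nonneg_measurable (fun t => c%:E * phi t).
  split=> [|u]; first exact: measurable_funeM.
  by rewrite mule_ge0// lee_fin ltW.
have [t0|t0] := ltP t 0%R; first by rewrite !nir_neg// gt0_muley.
have E s : (0 <= s)%R -> (s%:E < nir halfline_measure (fun t => c%:E * phi t) t) =
    (s%:E < c%:E * nir halfline_measure phi t).
  move=> s0; rewrite lt_nir// -lte_pdivrMl// -EFinM lt_nir//; last first.
    by rewrite mulr_ge0// invr_ge0 ltW.
  by congr (_ < halfline_measure _); apply/seteqP; split=> u /=;
    rewrite EFinM lte_pdivrMl.
apply/eqP; rewrite eq_le; apply/andP; split; apply: le_of_lt_real => [|s s0];
  rewrite ?nir_ge0 ?mule_ge0 ?nir_ge0// ?lee_fin ?(ltW c0)//.
  by rewrite E// => /ltW.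
by rewrite -E// => /ltW.
Qed.

(* Closed-graph principle: if no uniform bound held, a rapidly convergent sum
   of counterexamples would have finite A-norm and infinite B-norm. *)
Lemma closed_graph A B (p : T -> bool) (tau : T -> R) :
  ri_quasi_norm mu A -> ri_quasi_norm mu B ->
  measurable_fun [set: T] p -> measurable_fun [set: T] tau ->
  (forall phi, decreasing_nonneg phi -> A (xlift (sample p tau phi)) < +oo ->
     B (xlift (sample p tau (nir halfline_measure phi))) < +oo) ->
  exists C : R, (0 <= C)%R /\ forall phi, decreasing_nonneg phi ->
    nir halfline_measure phi = phi ->
    B (xlift (sample p tau phi)) <= C%:E * A (xlift (sample p tau phi)).
Proof.
move=> HA HB mp mtau AB; have [K [K1 triK]] := rqn_triangle HA.
have K0 : (0 < 2 * K)%R by rewrite mulr_gt0// (lt_le_trans _ K1).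
(* The factor n+1 will make the B-quasinorms unbounded; the power of 2K keeps the A-quasinorms
   summable by [norm_series]. *)
pose C n : R := (n.+1%:R * (2 * K) ^+ n.+1)%R.
have C0 n : (0 < C n)%R by rewrite mulr_gt0// exprn_gt0.
apply: contrapT => nC.
have /choice[phi_ phiP] : forall n, exists phi, [/\ decreasing_nonneg phi,
    nir halfline_measure phi = phi &
    (C n)%:E * A (xlift (sample p tau phi)) < B (xlift (sample p tau phi))].
  move=> n; apply: contrapT => H; apply: nC; exists (C n); split; first exact: ltW.
  move=> phi dphi fphi; rewrite leNgt; apply/negP => lt; apply: H.
  by exists phi.
have mphi n : nonneg_measurable (sample p tau (phi_ n)).
  by apply: measurable_sample => //; have [] := phiP n.
have A0 n : 0 <= A (xlift (sample p tau (phi_ n))) by exact: (norm_ge0 HA).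
have Afin n : A (xlift (sample p tau (phi_ n))) < +oo.
  have [_ _] := phiP n; rewrite !ltNge; apply: contra; rewrite leye_eq => /eqP ->.
  by rewrite gt0_muley ?lte_fin// leey.
have Bfin n : B (xlift (sample p tau (phi_ n))) < +oo.
  by have [dphi <- _] := phiP n; exact: AB.
pose a n := fine (A (xlift (sample p tau (phi_ n)))).
pose r n := fine (B (xlift (sample p tau (phi_ n)))).
have aE n : A (xlift (sample p tau (phi_ n))) = (a n)%:E.
  by rewrite fineK// ge0_fin_numE.
have rE n : B (xlift (sample p tau (phi_ n))) = (r n)%:E.
  by rewrite fineK// ge0_fin_numE//; exact: (norm_ge0 HB).
have a0 n : (0 <= a n)%R by rewrite -lee_fin -aE.
have ar n : (C n * a n < r n)%R.
  by have [_ _] := phiP n; rewrite aE rE -EFinM lte_fin.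
have r0 n : (0 < r n)%R by apply: le_lt_trans (ar n); rewrite mulr_ge0// ltW.
(* This scaling makes the B-quasinorm of the n-th term exactly n+1. *)
pose c n : R := (n.+1%:R / r n)%R.
have c0 n : (0 < c n)%R by rewrite divr_gt0.
pose h n t := (c n)%:E * phi_ n t.
have dh n : decreasing_nonneg (h n).
  have [[p0 dp] _ _] := phiP n; split=> [t|t u tu].
    by rewrite mule_ge0// lee_fin ltW.
  by rewrite lee_wpmul2l ?lee_fin ?(ltW (c0 n))// dp.
have fh n : nir halfline_measure (h n) = h n.
  have [dphi fphi _] := phiP n; rewrite nirZ//; last exact: measurable_decreasing.
  by rewrite fphi.
have hE n : sample p tau (h n) = fun x => (c n)%:E * sample p tau (phi_ n) x.
  by apply/funext => x; rewrite /sample; case: ifP => // _; rewrite mule0.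
have mh n : nonneg_measurable (sample p tau (h n)) by exact: measurable_sample.
have Bh n : B (xlift (sample p tau (h n))) = n.+1%:R%:E.
  rewrite hE (normZ HB) ?(ltW (c0 n))// rE -EFinM; congr _%:E.
  by rewrite /c divfK// gt_eqF.
have Ah n : A (xlift (sample p tau (h n))) <= (1 / (2 * K) ^+ n.+1)%:E.
  rewrite hE (normZ HA) ?(ltW (c0 n))// aE -EFinM lee_fin.
  rewrite ler_pdivlMr ?exprn_gt0//.
  have -> : (c n * a n * (2 * K) ^+ n.+1 = C n * a n / r n)%R.
    by rewrite /c /C; ring.
  by rewrite ler_pdivrMr// mul1r; exact/ltW/ar.
pose Phi t := \sum_(0 <= n <oo) h n t.
have hPhi n t : h n t <= Phi t.
  apply: le_trans (nneseries_lim_ge n.+1 _) => [|k _ _]; last exact: (dh k).1.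
  rewrite big_nat_recr//= leeDr// sume_ge0// => k _; exact: (dh k).1.
have dPhi : decreasing_nonneg Phi.
  split=> [t|t u tu]; first by apply: nneseries_ge0 => n _ _; exact: (dh n).1.
  apply: lee_nneseries => n *; first exact: (dh n).1.
  exact: (dh n).2.
have PhiE : sample p tau Phi = fun x => \sum_(0 <= n <oo) sample p tau (h n) x.
  apply/funext => x; rewrite /sample; case: ifP => // _.
  by rewrite eseries0.
have /(AB _ dPhi) : A (xlift (sample p tau Phi)) < +oo.
  rewrite PhiE; apply: le_lt_trans (ltry 1); exact: (norm_series HA K1 triK).
have mPhi' : nonneg_measurable (sample p tau (nir halfline_measure Phi)).
  by apply: measurable_sample => //; exact: decreasing_nir.
rewrite -ge0_fin_numE; last exact: (norm_ge0 HB).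
move=> /fineK; set b := fine _ => bE.
(* The term of index [Num.truncn b] has B-quasinorm above b. Yet it equals its own rearrangement and
   lies below [Phi], hence below the rearrangement of [Phi]. *)
have := truncnS_gt b; apply/negP; rewrite -leNgt -lee_fin bE -Bh.
apply: (le_norm HB) => // x; rewrite /sample; case: ifP => // _.
rewrite -{1}(fh (Num.truncn b)).
by apply: le_nir; [exact: measurable_decreasing..|apply: aeW => t; exact: hPhi].
Qed.

End QuasiNorm.

(** * Local and global components *)

Section AmalgamEstimates.
Set Implicit Arguments.
Unset Strict Implicit.
Unset Printing Implicit Defensive.
Context {R : realType}.

Lemma bound1 (k x : R) (X Y : \bar R) : (0 <= k)%R ->
  Y <= k%:E * X -> X <= x%:E -> Y <= (k * x)%:E.
Proof.
by move=> k0 YX Xx; apply: le_trans YX _; rewrite EFinM lee_wpmul2l ?lee_fin.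
Qed.

Lemma bound2 (k x y : R) (X Y Z : \bar R) : (0 <= k)%R ->
  Z <= k%:E * (X + Y) -> X <= x%:E -> Y <= y%:E -> Z <= (k * (x + y))%:E.
Proof.
by move=> k0 ZXY Xx Yy; apply: (bound1 k0 ZXY); rewrite EFinD; exact: leeD.
Qed.

(** A level above [phi t] can be exceeded only to the left of t, on a set of measure at most t.
    Equality may fail at jumps, where [phi] need not be right-continuous. *)
Lemma nir_decreasing_le (phi : R -> \bar R) t : decreasing_nonneg phi ->
  (0 <= t)%R -> nir halfline_measure phi t <= phi t.
Proof.
move=> dphi t0; apply: le_of_lt_real => [|s s0]; first exact: dphi.1.
have mphi := measurable_decreasing dphi.
rewrite lt_nir// leNgt; apply: contraL => phis; rewrite -leNgt.
apply: (@le_trans _ _ (@halfline_measure R `]-oo, t[%classic)).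
  apply: le_measure; rewrite ?inE//; first exact: measurable_above.
  move=> u /= su; rewrite in_itv/= ltNge; apply/negP => tu.
  by have := lt_trans (lt_le_trans su (dphi.2 _ _ tu)) phis; rewrite ltxx.
by rewrite (@halfline_initial _ _ t%:E)// => u u0; rewrite /= in_itv/= lte_fin.
Qed.

Context {d : measure_display} {T : measurableType d}.
Variable mu : {measure set T -> \bar R}.
Implicit Types (f : T -> xcomplex R) (g h : T -> \bar R) (phi : R -> \bar R).

Lemma nir_le_bound h (c : \bar R) t : nonneg_measurable h -> (0 <= t)%R ->
  0 <= c -> (forall x, h x <= c) -> nir mu h t <= c.
Proof.
move=> mh t0 c0 hc; apply: le_of_lt_real => // s s0.
rewrite lt_nir// leNgt; apply: contraL => cs; rewrite -leNgt.
rewrite (_ : [set _ | _] = set0) ?measure0//.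
apply/seteqP; split=> // x /= sh.
by have := lt_le_trans (lt_trans cs sh) (hc x); rewrite ltxx.
Qed.

(** With a and b the two values on the right, {g + h > a + b} is covered by {g > a} and {h > b},
    each of measure at most 1/2. *)
Lemma nir_le_add g h : nonneg_measurable g -> nonneg_measurable h ->
  nir mu (g \+ h) 1 <= nir mu g 2^-1 + nir mu h 2^-1.
Proof.
move=> mg mh.
have mgh : nonneg_measurable (g \+ h).
  split=> [|x]; first by apply: emeasurable_funD; [exact: mg.1|exact: mh.1].
  by rewrite adde_ge0//; [exact: mg.2|exact: mh.2].
have h0 : (0 <= 2^-1 :> R)%R by [].
have g0 := nir_ge0 mu g 2^-1%R; have h0' := nir_ge0 mu h 2^-1%R.
have [->|gfin] := eqVneq (nir mu g 2^-1) +oo.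
  by rewrite addye ?leey// gt_eqF// (lt_le_trans _ h0').
have [->|hfin] := eqVneq (nir mu h 2^-1) +oo.
  by rewrite addey ?leey// gt_eqF// (lt_le_trans _ g0).
pose a := fine (nir mu g 2^-1); pose b := fine (nir mu h 2^-1).
have aE : nir mu g 2^-1 = a%:E by rewrite fineK// ge0_fin_numE// ltey.
have bE : nir mu h 2^-1 = b%:E by rewrite fineK// ge0_fin_numE// ltey.
have a0 : (0 <= a)%R by exact: fine_ge0.
have b0 : (0 <= b)%R by exact: fine_ge0.
have ha : mu [set x | a%:E < g x] <= 2^-1%:E by rewrite -nir_le_real// aE.
have hb : mu [set x | b%:E < h x] <= 2^-1%:E by rewrite -nir_le_real// bE.
rewrite aE bE.
rewrite -EFinD nir_le_real ?addr_ge0//.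
apply: (@le_trans _ _ (mu ([set x | a%:E < g x] `|` [set x | b%:E < h x]))).
  apply: le_measure; rewrite ?inE; first exact: measurable_above.
    by apply: measurableU; exact: measurable_above.
  move=> x /= abgh; have [|ga] := ltP a%:E (g x); [by left|right].
  rewrite ltNge; apply/negP => hb'; move: abgh; rewrite ltNge => /negP; apply.
  by rewrite EFinD leeD.
apply: (le_trans (measureU2 _ (measurable_above _ mg) (measurable_above _ mh))).
rewrite (_ : 1%R = 2^-1 + 2^-1 :> R)%R; last by field.
by rewrite EFinD leeD.
Qed.

Variable s : T -> R.
Hypothesis ms : measure_preserving mu s.

Definition loc := sample (fun x => s x <= 1)%R s.
Definition tail := sample (fun x => 1 < s x)%R s.
(** Unlike [tail], which vanishes on {s <= 1}, this equals [phi 1] there: it stays nonincreasing in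
    s, and its quasinorm controls [phi 1]. *)
Definition glb := sample (fun=> true) (fun x => Num.max (s x) 1%R).

Let mes_s : measurable_fun [set: T] s. Proof. by case: ms. Qed.
Let s_ge0 x : (0 <= s x)%R. Proof. by case: ms. Qed.

Let mes_le1 : measurable_fun [set: T] (fun x => s x <= 1)%R.
Proof. exact: measurable_fun_ler. Qed.

Let mes_max : measurable_fun [set: T] (fun x => Num.max (s x) 1%R).
Proof. exact: measurable_maxr. Qed.

Lemma measurable_loc phi : decreasing_nonneg phi -> nonneg_measurable (loc phi).
Proof. by move=> dphi; exact: measurable_sample. Qed.

Lemma measurable_tail phi : decreasing_nonneg phi -> nonneg_measurable (tail phi).
Proof.
by move=> dphi; apply: measurable_sample => //; exact: measurable_fun_ltr.
Qed.

Lemma measurable_glb phi : decreasing_nonneg phi -> nonneg_measurable (glb phi).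
Proof. by move=> dphi; exact: measurable_sample. Qed.

Lemma measurable_nir_comp h : nonneg_measurable (nir mu h \o s).
Proof. by apply: (nonneg_measurable_comp ms); exact: nonneg_measurable_nir. Qed.

Lemma measure_initial (a : R) : (0 <= a)%R ->
  mu (s @^-1` `]-oo, a]%classic) = a%:E.
Proof.
move=> a0; case: ms => _ _ ->//; rewrite /halfline_measure /mrestr.
have -> : `]-oo, a]%classic `&` `[0%R, +oo[%classic = `[0%R, a]%classic.
  apply/seteqP; split=> t /=; rewrite !in_itv/= ?andbT.
    by move=> [-> ->].
  by move=> /andP[].
rewrite lebesgue_measure_itv/= lte_fin sube0.
by have [//|a0'] := ltP 0%R a; congr _%:E; apply/le_anti; rewrite a0.
Qed.

Lemma le_loc phi psi x : (forall t, (0 <= t)%R -> phi t <= psi t) ->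
  loc phi x <= loc psi x.
Proof. by move=> le; rewrite /loc /sample; case: ifP => // _; exact: le. Qed.

Lemma le_tail phi psi x : (forall t, (0 <= t)%R -> phi t <= psi t) ->
  tail phi x <= tail psi x.
Proof. by move=> le; rewrite /tail /sample; case: ifP => // _; exact: le. Qed.

Lemma tail_le_glb phi x : (forall t, 0 <= phi t) -> tail phi x <= glb phi x.
Proof.
move=> phi0; rewrite /tail /glb /sample; case: ifPn => // s1.
by rewrite max_l// ltW.
Qed.

Lemma loc_le phi x : (forall t, 0 <= phi t) -> loc phi x <= phi (s x).
Proof. by move=> phi0; rewrite /loc /sample; case: ifP. Qed.

Lemma glb_le phi x : decreasing_nonneg phi -> glb phi x <= phi (s x).
Proof. by move=> dphi; rewrite /glb /sample; apply: dphi.2; rewrite le_max lexx. Qed.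

(** * Quasinorm estimates for local and global parts *)

Section OneNorm.
Variable N : (T -> xcomplex R) -> \bar R.
Hypothesis HN : ri_quasi_norm mu N.

Lemma norm_loc_le h : nonneg_measurable h ->
  N (xlift (loc (nir mu h))) <= N (xlift h).
Proof.
move=> mh; rewrite -[leRHS](norm_nir HN ms mh); apply: (le_norm HN) => [||x].
- exact/measurable_loc/decreasing_nir.
- exact: measurable_nir_comp.
- by apply: loc_le => t; exact: nir_ge0.
Qed.

Lemma norm_glb_le h : nonneg_measurable h ->
  N (xlift (glb (nir mu h))) <= N (xlift h).
Proof.
move=> mh; rewrite -[leRHS](norm_nir HN ms mh); apply: (le_norm HN) => [||x].
- exact/measurable_glb/decreasing_nir.
- exact: measurable_nir_comp.
- by apply: glb_le; exact: decreasing_nir.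
Qed.

Lemma norm_tail_le phi : decreasing_nonneg phi ->
  N (xlift (tail phi)) <= N (xlift (glb phi)).
Proof.
move=> dphi; apply: (le_norm HN) => [||x]; first exact: measurable_tail.
  exact: measurable_glb.
by apply: tail_le_glb; exact: dphi.1.
Qed.

Lemma norm_split : exists K : R, (0 <= K)%R /\ forall h, nonneg_measurable h ->
  N (xlift h) <= K%:E * (N (xlift (loc (nir mu h))) + N (xlift (glb (nir mu h)))).
Proof.
have [K [K1 triK]] := rqn_triangle HN; exists K; split=> [|h mh].
  exact: le_trans K1.
have dh : decreasing_nonneg (nir mu h) by exact: decreasing_nir.
have ml := measurable_loc dh; have mg := measurable_glb dh.
rewrite -[leLHS](norm_nir HN ms mh); apply: le_trans (triK _ _ ml mg).
apply: (le_norm HN) => [||x]; first exact: measurable_nir_comp.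
  split=> [|x]; first by apply: emeasurable_funD; [exact: ml.1|exact: mg.1].
  by rewrite adde_ge0//; [exact: ml.2|exact: mg.2].
rewrite /loc /glb /sample/=; have [s1|s1] := leP (s x) 1%R.
  by rewrite leeDl// nir_ge0.
by rewrite add0e.
Qed.

(** On {s <= a}, a set of measure a, the transported rearrangement is at least its value at a, so
    [level_bound] applies. *)
Lemma nir_level (a : R) : (0 < a)%R -> exists C : R, (0 <= C)%R /\
  forall h, nonneg_measurable h -> nir mu h a <= C%:E * N (xlift h).
Proof.
move=> a0; have mE : measurable (s @^-1` `]-oo, a]%classic).
  by rewrite -[X in measurable X]setTI; exact: mes_s.
have muE := measure_initial (ltW a0).
have [||C [C0 CP]] := level_bound HN mE; rewrite ?muE ?lte_fin ?ltry//.
exists C; split=> // h mh; rewrite -(norm_nir HN ms mh); apply: CP.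
- exact: nir_ge0.
- exact: measurable_nir_comp.
- by move=> x /=; rewrite in_itv/= => sa; exact: nir_nonincreasing.
Qed.

(** Both parts are at least [phi 1] on {s <= 1}, a set of measure 1. *)
Lemma loc_glb_level : exists C : R, (0 <= C)%R /\
  forall phi, decreasing_nonneg phi ->
  phi 1%R <= C%:E * N (xlift (loc phi)) /\
  phi 1%R <= C%:E * N (xlift (glb phi)).
Proof.
have mE : measurable (s @^-1` `]-oo, 1%R]%classic).
  by rewrite -[X in measurable X]setTI; exact: mes_s.
have muE := measure_initial ler01.
have [||C [C0 CP]] := level_bound HN mE; rewrite ?muE ?lte_fin ?ltry//.
exists C; split=> // phi dphi; split; apply: CP; try exact: dphi.1.
- exact: measurable_loc.
- move=> x /=; rewrite in_itv/= => s1; rewrite /loc /sample s1; exact: dphi.2.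
- exact: measurable_glb.
- by move=> x /=; rewrite in_itv/= => s1; rewrite /glb /sample max_r.
Qed.

(** The quasi-triangle inequality is applied to g and c times the indicator of {s <= 1}, whose
    quasinorm is finite. Positivity of C makes the bound trivial when c is infinite. *)
Lemma norm_add_level : exists C : R, (0 < C)%R /\ forall (c : \bar R) g h,
  0 <= c -> nonneg_measurable g -> nonneg_measurable h ->
  (forall x, h x <= g x + (if (s x <= 1)%R then c else 0)) ->
  N (xlift h) <= C%:E * (N (xlift g) + c).
Proof.
have [K [K1 triK]] := rqn_triangle HN.
have K0 : (0 < K)%R by exact: lt_le_trans K1.
have mE : measurable (s @^-1` `]-oo, 1%R]%classic).
  by rewrite -[X in measurable X]setTI; exact: mes_s.
have muE := measure_initial ler01.
pose chi x : \bar R := (\1_(s @^-1` `]-oo, 1%R]%classic) x)%:E.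
have mchi : nonneg_measurable chi.
  by split=> [|x]; [exact/measurable_EFinP/measurable_indic|rewrite lee_fin].
have chifin : N (xlift chi) < +oo by apply: (rqn_indic HN); rewrite ?muE ?ltry.
have chi0 := norm_ge0 HN mchi.
pose r := fine (N (xlift chi)).
have rE : N (xlift chi) = r%:E by rewrite fineK// ge0_fin_numE.
have r0 : (0 <= r)%R by rewrite -lee_fin -rE.
exists (K * (1 + r))%R; split=> [|c g h c0 mg mh hgc].
  by rewrite mulr_gt0// ltr_pwDl.
have Kr : (0 < K * (1 + r))%R by rewrite mulr_gt0// ltr_pwDl.
have Ng0 := norm_ge0 HN mg.
case: c c0 hgc => [c| |]// c0 hgc; last first.
  by rewrite addey ?gt_eqF ?(lt_le_trans _ Ng0)// gt0_muley ?lte_fin// leey.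
rewrite lee_fin in c0.
have mc : nonneg_measurable (fun x => c%:E * chi x).
  split=> [|x]; first by apply: measurable_funeM; exact: mchi.1.
  by rewrite mule_ge0 ?lee_fin.
apply: (@le_trans _ _ (K%:E * (N (xlift g) + c%:E * r%:E))).
  rewrite -rE -(normZ HN c0 mchi); apply: le_trans (triK _ _ mg mc).
  apply: (le_norm HN) => [//||x].
    split=> [|x]; first by apply: emeasurable_funD; [exact: mg.1|exact: mc.1].
    by rewrite adde_ge0//; [exact: mg.2|exact: mc.2].
  apply: le_trans (hgc x) _; rewrite /chi indicE/=.
  rewrite (_ : (x \in _) = (s x <= 1)%R); last first.
    by apply/idP/idP => [/set_mem|s1]; rewrite ?inE /= in_itv.
  by case: ifP => _; rewrite ?mule1 ?mule0.
rewrite EFinM -muleA; apply: lee_wpmul2l; first by rewrite lee_fin ltW.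
case: (N (xlift g)) Ng0 => [n| |]// n0.
  have {}n0 : (0 <= n)%R by rewrite -lee_fin.
  by rewrite -EFinM -!EFinD -EFinM lee_fin; nra.
by rewrite !addye// gt0_muley ?lte_fin ?ltr_pwDl// leey.
Qed.

Lemma glb_add_level : exists C : R, (0 < C)%R /\ forall phi,
  decreasing_nonneg phi ->
  N (xlift (glb phi)) <= C%:E * (N (xlift (tail phi)) + phi 1%R).
Proof.
have [C [C0 CP]] := norm_add_level; exists C; split=> // phi dphi.
apply: CP; [exact: dphi.1|exact: measurable_tail|exact: measurable_glb|move=> x].
rewrite /tail /glb /sample; have [s1|s1] := leP (s x) 1%R.
  by rewrite add0e.
by rewrite adde0.
Qed.

(** The rearrangement of g vanishes beyond 1 because g lives on a set of measure at most 1; up to 1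
    it is below that of h. *)
Lemma norm_le_loc g h : nonneg_measurable g -> nonneg_measurable h ->
  (forall x, g x <= h x) -> mu [set x | 0 < g x] <= 1 ->
  N (xlift g) <= N (xlift (loc (nir mu h))).
Proof.
move=> mg mh gh g1; rewrite -[leLHS](norm_nir HN ms mg).
apply: (le_norm HN) => [||x]; first exact: measurable_nir_comp.
  exact/measurable_loc/decreasing_nir.
rewrite /loc /sample /=; have [s1|s1] := leP (s x) 1%R.
  by apply: le_nir => //; exact: aeW.
by rewrite nir_le_real//; apply: le_trans g1 _; rewrite lee_fin ltW.
Qed.

(** On [0,1] the rearrangement of g is at most the cap h^*(1), and beyond 1 it is at most that of
    h. *)
Lemma norm_le_glb g h : nonneg_measurable g -> nonneg_measurable h ->
  (forall x, g x <= h x) -> (forall x, g x <= nir mu h 1%R) ->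
  N (xlift g) <= N (xlift (glb (nir mu h))).
Proof.
move=> mg mh gh g1; rewrite -[leLHS](norm_nir HN ms mg).
apply: (le_norm HN) => [||x]; first exact: measurable_nir_comp.
  exact/measurable_glb/decreasing_nir.
rewrite /glb /sample /=; have [s1|s1] := leP (s x) 1%R.
  by apply: nir_le_bound => //; exact: nir_ge0.
by apply: le_nir => //; exact: aeW.
Qed.

End OneNorm.
End AmalgamEstimates.

(** * Embeddings of amalgams *)

Section Amalgams.
Set Implicit Arguments.
Unset Strict Implicit.
Unset Printing Implicit Defensive.
Context {R : realType} {d : measure_display} {T : measurableType d}.
Variable mu : {measure set T -> \bar R}.
Hypothesis ms : measure_preserving mu (sigma_map mu).
Implicit Types (f : T -> xcomplex R) (g h : T -> \bar R) (phi : R -> \bar R).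

Local Notation loc := (loc (sigma_map mu)).
Local Notation tail := (tail (sigma_map mu)).
Local Notation glb := (glb (sigma_map mu)).

Let s_ge0 x : (0 <= sigma_map mu x)%R. Proof. by case: ms. Qed.

Lemma nonneg_measurable_restrict (D : set R) phi : measurable D ->
  decreasing_nonneg phi -> nonneg_measurable (phi \_ D).
Proof.
move=> mD dphi; have [mphi phi0] := measurable_decreasing dphi.
split=> [|x]; last by rewrite patchE; case: ifP.
by apply/(measurable_restrictT _ mD); exact: measurable_funTS.
Qed.

Section OneNorm.
Variable N : (T -> xcomplex R) -> \bar R.
Hypothesis HN : ri_quasi_norm mu N.

Lemma rep_norm_local phi : decreasing_nonneg phi ->
  rep_norm mu N (local_part phi) = N (xlift (loc phi)).
Proof.
move=> dphi; rewrite /local_part rep_norm_xlift//; last first.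
  exact: nonneg_measurable_restrict.
congr (N (xlift _)); apply/funext => x; rewrite /loc /sample /= patchE.
by rewrite mem_setE in_itv/= s_ge0.
Qed.

Lemma rep_norm_global phi : decreasing_nonneg phi ->
  rep_norm mu N (global_part phi) = N (xlift (tail phi)).
Proof.
move=> dphi; rewrite /global_part rep_norm_xlift//; last first.
  exact: nonneg_measurable_restrict.
congr (N (xlift _)); apply/funext => x; rewrite /tail /sample /= patchE.
by rewrite mem_setE in_itv/= andbT.
Qed.

End OneNorm.

Lemma norm_modulus N f : ri_quasi_norm mu N -> xmeasurable f ->
  N f = N (xlift (modulus f)).
Proof. by move=> HN mf; rewrite (rqn_mod HN). Qed.

Lemma WLE A B f : ri_quasi_norm mu A -> ri_quasi_norm mu B ->
  WL mu A B f = A (xlift (loc (nir mu (modulus f)))) +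
    B (xlift (tail (nir mu (modulus f)))).
Proof.
move=> HA HB; rewrite /WL rearrE rep_norm_local ?rep_norm_global//; exact: decreasing_nir.
Qed.

(** * Embeddings between intersection, amalgam and sum *)

Variables A B : (T -> xcomplex R) -> \bar R.
Hypotheses (HA : ri_quasi_norm mu A) (HB : ri_quasi_norm mu B).

Lemma cap_embeds_WL : embeds (cap_norm A B) (WL mu A B).
Proof.
exists 2%R; split=> // f mf; rewrite (WLE _ HA HB) /cap_norm.
have mh := measurable_modulus mf.
have Al : A (xlift (loc (nir mu (modulus f)))) <= A f.
  by rewrite (norm_modulus HA mf); exact: norm_loc_le.
have Bl : B (xlift (tail (nir mu (modulus f)))) <= B f.
  rewrite (norm_modulus HB mf); apply: le_trans (norm_glb_le ms HB mh).
  by apply: (norm_tail_le ms HB); exact: decreasing_nir.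
rewrite mule_natl mule2n; apply: leeD.
  by apply: le_trans Al _; rewrite le_max lexx.
by apply: le_trans Bl _; rewrite le_max lexx orbT.
Qed.

(** An infinite amalgam quasinorm makes the bound trivial because C > 0, so only functions with two
    finite parts need an estimate, in real arithmetic. *)
Lemma WL_embeds_of_finite (Y : (T -> xcomplex R) -> \bar R) :
  (exists C : R, (0 < C)%R /\ forall f (a b : R), xmeasurable f ->
     (0 <= a)%R -> (0 <= b)%R ->
     A (xlift (loc (nir mu (modulus f)))) = a%:E ->
     B (xlift (tail (nir mu (modulus f)))) = b%:E -> Y f <= (C * (a + b))%:E) ->
  embeds (WL mu A B) Y.
Proof.
move=> [C [C0 CP]]; exists C; split=> [|f mf]; first exact: ltW.
have [->|WLfin] := eqVneq (WL mu A B f) +oo.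
  by rewrite gt0_muley ?lte_fin// leey.
have dh := decreasing_nir mu (modulus f).
have a0 := norm_ge0 HA (measurable_loc ms dh).
have b0 := norm_ge0 HB (measurable_tail ms dh).
move: WLfin; rewrite (WLE _ HA HB).
case aE : (A _) a0 => [a| |]//; last by rewrite addye// gt_eqF// (lt_le_trans _ b0).
case bE : (B _) b0 => [b| |]//; rewrite !lee_fin => b0 a0 _.
by rewrite -EFinD -EFinM; exact: CP.
Qed.

Lemma WL_embeds_sum : embeds (WL mu A B) (sum_norm mu A B).
Proof.
apply: WL_embeds_of_finite.
have [C1 [C10 C1P]] := loc_glb_level ms HA.
have [C2 [C20 C2P]] := glb_add_level ms HB.
exists (1 + C2 * (1 + C1))%R; split=> [|f a b mf a0 b0 aE bE].
  by rewrite ltr_pwDl// mulr_ge0 ?(ltW C20)// addr_ge0.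
have mh := measurable_modulus mf.
have dh := decreasing_nir mu (modulus f).
set phi := nir mu (modulus f) in aE bE dh *.
have phi1 : phi 1%R <= (C1 * a)%:E.
  by have [+ _] := C1P _ dh; rewrite aE -EFinM.
have : phi 1%R \is a fin_num.
  by rewrite ge0_fin_numE ?(le_lt_trans phi1) ?ltry//; exact: nir_ge0.
move=> /fineK; set c := fine _ => cE.
have c0 : (0 <= c)%R by rewrite fine_ge0//; exact: nir_ge0.
(* At each point one summand is f and the other 0. Infinite values of f exceed c and go to [fA], so
   the decomposition holds everywhere. *)
pose fA x := if c%:E < modulus f x then f x else Some 0%R.
pose fB x := if c%:E < modulus f x then Some 0%R else f x.
have mc : measurable_fun [set: T] (fun x => c%:E < modulus f x).
  by apply: measurable_fun_lte => //; exact: mh.1.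
have mfA : xmeasurable fA.
  have [mRe mIm] := mf; split.
    rewrite (_ : (fun x => _) = fun x => if c%:E < modulus f x then xRe (f x) else 0).
      exact: measurable_fun_ifT.
    by apply/funext => x; rewrite /fA; case: ifP.
  rewrite (_ : (fun x => _) = fun x => if c%:E < modulus f x then xIm (f x) else 0).
    exact: measurable_fun_ifT.
  by apply/funext => x; rewrite /fA; case: ifP.
have mfB : xmeasurable fB.
  have [mRe mIm] := mf; split.
    rewrite (_ : (fun x => _) = fun x => if c%:E < modulus f x then 0 else xRe (f x)).
      exact: measurable_fun_ifT.
    by apply/funext => x; rewrite /fB; case: ifP.
  rewrite (_ : (fun x => _) = fun x => if c%:E < modulus f x then 0 else xIm (f x)).
    exact: measurable_fun_ifT.
  by apply/funext => x; rewrite /fB; case: ifP.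
have xmod0 : xmod (Some (0 : R[i])%R) = 0.
  by rewrite /= expr0n/= addr0 sqrtr0.
have AfA : A fA <= a%:E.
  rewrite (norm_modulus HA mfA) -aE; apply: (norm_le_loc ms HA) => //.
  - exact: measurable_modulus.
  - by move=> x; rewrite /modulus /fA; case: ifP => // _; rewrite xmod0 xmod_ge0.
  (* The support of [fA] has measure at most 1 because c = f^*(1). *)
  - apply: (@le_trans _ _ (mu [set x | c%:E < modulus f x])).
      apply: le_measure; rewrite ?inE; [exact/measurable_above/measurable_modulus|
        exact: measurable_above|].
      move=> x /=; rewrite {1}/modulus /fA; case: ifP => //.
      by rewrite xmod0 ltxx.
    by rewrite -nir_le_real// cE.
have BfB : B fB <= (C2 * (b + C1 * a))%:E.
  apply: (@le_trans _ _ (B (xlift (glb phi)))).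
    rewrite (norm_modulus HB mfB); apply: (norm_le_glb ms HB) => //.
    - exact: measurable_modulus.
    - by move=> x; rewrite /modulus /fB; case: ifP => // _; rewrite xmod0 xmod_ge0.
    - move=> x; rewrite /modulus /fB; case: ifPn; last by rewrite -leNgt -/phi -cE.
      by rewrite xmod0 nir_ge0.
  apply: (bound2 (ltW C20) (C2P _ dh)) => //.
  by rewrite bE.
apply: (@le_trans _ _ (A fA + B fB)); last first.
  apply: le_trans (leeD AfA BfB) _; rewrite -EFinD lee_fin.
  have := mulr_ge0 (ltW C20) a0; have := mulr_ge0 (ltW C20) b0.
  have := mulr_ge0 (mulr_ge0 (ltW C20) C10) b0; nra.
apply: ereal_inf_lbound; exists fA, fB; split=> //.
- by split=> //; apply: le_lt_trans AfA (ltry _).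
- by split=> //; apply: le_lt_trans BfB (ltry _).
- apply: aeW => x; rewrite /fA /fB; case: ifP => _; case: (f x) => //= z.
    by rewrite addr0.
  by rewrite add0r.
Qed.

(** By [closed_graph]: the rearrangement of a decreasing [phi] lies below [phi], so finiteness
    passes to it and the qualitative comparison applies. *)
Lemma local_bound : local_stronger mu A B -> exists C : R, (0 <= C)%R /\
  forall h, nonneg_measurable h ->
  B (xlift (loc (nir mu h))) <= C%:E * A (xlift (loc (nir mu h))).
Proof.
move=> locAB; have mes_s : measurable_fun [set: T] (sigma_map mu) by case: ms.
have [||phi dphi Afin|C [C0 CP]] :=
  @closed_graph R d T mu A B (fun x => sigma_map mu x <= 1)%R (sigma_map mu) HA HB.
- exact: measurable_fun_ler.
- exact: mes_s.
- have dn := decreasing_nir (@halfline_measure R) phi.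
  rewrite -/(loc _) -rep_norm_local//; apply: locAB.
    by apply: xmeasurable_xlift; exact: measurable_decreasing.
  rewrite -/(nir _ _) rep_norm_local//; apply: le_lt_trans Afin.
  apply: (le_norm HA) => [||x]; [exact: (measurable_loc ms)..|].
  by apply: (le_loc ms) => // t t0; exact: nir_decreasing_le.
- exists C; split=> // h mh; apply: CP; first exact: decreasing_nir.
  exact: nir_nir.
Qed.

(** [closed_graph] is applied to [glb] rather than [tail]: finiteness of its B-quasinorm forces
    [phi 1] to be finite, as the qualitative comparison demands, and [phi 1] also pays for passing
    from [tail] back to [glb]. *)
Lemma global_bound : global_stronger mu B A -> exists C : R, (0 <= C)%R /\
  forall h, nonneg_measurable h ->
  A (xlift (glb (nir mu h))) <= C%:E * B (xlift (glb (nir mu h))).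
Proof.
move=> globBA; have mes_s : measurable_fun [set: T] (sigma_map mu) by case: ms.
have [C1 [C10 C1P]] := loc_glb_level ms HB.
have [C2 [C20 C2P]] := glb_add_level ms HA.
have [||phi dphi Bfin|C [C0 CP]] :=
  @closed_graph R d T mu B A (fun=> true) (fun x => Num.max (sigma_map mu x) 1%R)
    HB HA.
- exact: measurable_cst.
- exact: measurable_maxr.
- have dn := decreasing_nir (@halfline_measure R) phi.
  have phi1 : nir halfline_measure phi 1%R < +oo.
    apply: le_lt_trans (nir_decreasing_le dphi ler01) _.
    have [_ /le_lt_trans] := C1P _ dphi; apply.
    by apply: lte_mul_pinfty; rewrite ?lee_fin.
  apply: le_lt_trans (C2P _ dn) _.
  apply: lte_mul_pinfty; rewrite ?lee_fin ?(ltW C20)//.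
  apply: lte_add_pinfty => //; rewrite -rep_norm_global//; apply: globBA => //.
    by apply: xmeasurable_xlift; exact: measurable_decreasing.
  rewrite -/(nir _ _) rep_norm_global//; apply: le_lt_trans Bfin.
  apply: le_trans (norm_tail_le ms HB dphi).
  apply: (le_norm HB) => [||x]; [exact: (measurable_tail ms)..|].
  by apply: (le_tail ms) => // t t0; exact: nir_decreasing_le.
- exists C; split=> // h mh; apply: CP; first exact: decreasing_nir.
  exact: nir_nir.
Qed.

(** Each quasinorm of f is split into local and flattened global parts. B controls A globally, A
    controls B locally, and flattening the tail costs f^*(1), which the local part in A controls. *)
Lemma WL_embeds_cap : local_stronger mu A B -> global_stronger mu B A ->
  embeds (WL mu A B) (cap_norm A B).
Proof.
move=> /local_bound[CL [CL0 CLP]] /global_bound[CG [CG0 CGP]].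
apply: WL_embeds_of_finite.
have [C1 [C10 C1P]] := loc_glb_level ms HA.
have [C2 [C20 C2P]] := glb_add_level ms HB.
have [KA [KA0 KAP]] := norm_split ms HA.
have [KB [KB0 KBP]] := norm_split ms HB.
pose P := (C2 * (1 + C1))%R.
have P0 : (0 <= P)%R by rewrite mulr_ge0 ?(ltW C20)// addr_ge0.
(* The 1 gives strict positivity; the other summands come from the bounds on [A f] and [B f]. *)
exists (1 + KA * (1 + CG * P) + KB * (CL + P))%R.
have Q1 : (0 <= KA * (1 + CG * P))%R.
  by rewrite mulr_ge0// addr_ge0// mulr_ge0.
have Q2 : (0 <= KB * (CL + P))%R by rewrite mulr_ge0// addr_ge0.
split=> [|f a b mf a0 b0 aE bE].
  by rewrite -addrA ltr_pwDl// addr_ge0.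
have mh := measurable_modulus mf.
have dh := decreasing_nir mu (modulus f).
have ab0 : (0 <= a + b)%R by exact: addr_ge0.
have phi1 : nir mu (modulus f) 1%R <= (C1 * a)%:E.
  by have [+ _] := C1P _ dh; rewrite aE -EFinM.
have aab : A (xlift (loc (nir mu (modulus f)))) <= (a + b)%:E.
  by rewrite aE lee_fin lerDl.
have gab : B (xlift (glb (nir mu (modulus f)))) <= (P * (a + b))%:E.
  have bb : B (xlift (tail (nir mu (modulus f)))) <= b%:E by rewrite bE.
  apply: le_trans (bound2 (ltW C20) (C2P _ dh) bb phi1) _.
  rewrite lee_fin /P -mulrA ler_wpM2l ?(ltW C20)//.
  by have := mulr_ge0 C10 b0; nra.
have Af : A f <= (KA * ((a + b) + CG * (P * (a + b))))%:E.
  rewrite (norm_modulus HA mf).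
  exact: (bound2 KA0 (KAP _ mh) aab (bound1 CG0 (CGP _ mh) gab)).
have Bf : B f <= (KB * (CL * (a + b) + P * (a + b)))%:E.
  rewrite (norm_modulus HB mf).
  exact: (bound2 KB0 (KBP _ mh) (bound1 CL0 (CLP _ mh) aab) gab).
have Q1ab := mulr_ge0 Q1 ab0; have Q2ab := mulr_ge0 Q2 ab0.
rewrite /cap_norm ge_max; apply/andP; split.
  by apply: le_trans Af _; rewrite lee_fin; nra.
by apply: le_trans Bf _; rewrite lee_fin; nra.
Qed.

Lemma sum_estimate : local_stronger mu A B -> global_stronger mu B A ->
  exists P : R, (0 <= P)%R /\ forall a b (r : R),
    nonneg_measurable a -> nonneg_measurable b -> (0 <= r)%R ->
    A (xlift a) <= r%:E -> B (xlift b) <= r%:E ->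
    B (xlift (loc (nir mu (a \+ b)))) + A (xlift (tail (nir mu (a \+ b)))) <=
    (P * r)%:E.
Proof.
move=> /local_bound[CL [CL0 CLP]] /global_bound[CG [CG0 CGP]].
have [C1 [C10 C1P]] : exists C : R, (0 <= C)%R /\
    forall h, nonneg_measurable h -> nir mu h 2^-1%R <= C%:E * A (xlift h).
  by apply: (nir_level ms HA); rewrite invr_gt0.
have [C2 [C20 C2P]] : exists C : R, (0 <= C)%R /\
    forall h, nonneg_measurable h -> nir mu h 2^-1%R <= C%:E * B (xlift h).
  by apply: (nir_level ms HB); rewrite invr_gt0.
have [C3 [/ltW C30 C3P]] := norm_add_level ms HB.
have [C4 [/ltW C40 C4P]] := norm_add_level ms HA.
have [KA [KA1 KAP]] := rqn_triangle HA.
have [KB [KB1 KBP]] := rqn_triangle HB.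
have KA0 : (0 <= KA)%R by exact: le_trans KA1.
have KB0 : (0 <= KB)%R by exact: le_trans KB1.
exists (C3 * (KB * (CL + 1) + (C1 + C2)) + KA * (1 + C4 * (CG + (C1 + C2))))%R.
split=> [|a b r ma mb r0 Aa Bb].
  by rewrite ?(addr_ge0, mulr_ge0).
have mg : nonneg_measurable (a \+ b).
  split=> [|x]; first by apply: emeasurable_funD; [exact: ma.1|exact: mb.1].
  by rewrite adde_ge0//; [exact: ma.2|exact: mb.2].
have dg := decreasing_nir mu (a \+ b).
set c := nir mu (a \+ b) 1%R.
have cr : c <= ((C1 + C2) * r)%:E.
  apply: (@le_trans _ _ (nir mu a 2^-1 + nir mu b 2^-1)).
    exact: nir_le_add.
  rewrite mulrDl EFinD; apply: leeD.
    exact: bound1 C10 (C1P _ ma) Aa.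
  exact: bound1 C20 (C2P _ mb) Bb.
have c0 : 0 <= c by exact: nir_ge0.
have cE : c = (fine c)%:E.
  by rewrite fineK// ge0_fin_numE//; apply: le_lt_trans cr (ltry _).
have fc0 : (0 <= fine c)%R by exact: fine_ge0.
pose F x := c < (a \+ b) x.
have mF : measurable_fun [set: T] F.
  by apply: measurable_fun_lte => //; exact: mg.1.
have mcut h : nonneg_measurable h -> nonneg_measurable (fun x => if F x then h x else 0).
  move=> [mh h0]; split=> [|x]; first exact: measurable_fun_ifT.
  by case: ifP.
have muF : mu [set x | F x] <= 1 by rewrite /F cE -nir_le_real// -cE.
have mcutg := mcut _ mg; have mcuta := mcut _ ma.
set h0 := (fun x => if F x then (a \+ b) x else 0) in mcutg.
set a0 := (fun x => if F x then a x else 0) in mcuta.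
(* Here [a0] lives on a set of measure at most 1, so B sees only the local part of a, which A
   controls; b is kept whole. *)
have Bh0 : B (xlift h0) <= (KB * (CL * r + r))%:E.
  apply: (@bound2 _ _ _ _ (B (xlift a0)) (B (xlift b)) _ KB0) => //.
    apply: le_trans (KBP _ _ mcuta mb); apply: (le_norm HB) => // [|x].
      split=> [|x]; first by apply: emeasurable_funD; [exact: mcuta.1|exact: mb.1].
      by rewrite adde_ge0//; [exact: mcuta.2|exact: mb.2].
    by rewrite /h0 /a0 /=; case: ifP => // _; rewrite add0e mb.2.
  apply: (@le_trans _ _ (B (xlift (loc (nir mu a))))).
    apply: (norm_le_loc ms HB) => // [x|].
      by rewrite /a0; case: ifP => // _; exact: ma.2.
    apply: le_trans muF; apply: le_measure; rewrite ?inE.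
    - exact: measurable_above.
    - exact: measurable_above.
    - by move=> x /=; rewrite /a0; case: ifP => //; rewrite ltxx.
  apply: (bound1 CL0 (CLP _ ma)); apply: le_trans Aa.
  exact: (norm_loc_le ms HA).
(* The rearrangement of a + b is at most that of [h0] plus c: levels up to c are absorbed by c, and
   above c both functions have the same superlevel sets. *)
have Bloc : B (xlift (loc (nir mu (a \+ b)))) <=
    (C3 * (KB * (CL * r + r) + (C1 + C2) * r))%:E.
  apply: (@bound2 _ _ _ _ (B (xlift h0)) c _ C30) => //.
  rewrite -(norm_nir HB ms mcutg); apply: C3P => // [||x].
  - exact: (measurable_nir_comp ms).
  - exact: (measurable_loc ms).
  have s0 := s_ge0 x; rewrite /loc /sample /=; case: ifP => _; last first.
    by rewrite adde0 nir_ge0.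
  apply: le_of_lt_real => [|u u0]; first by rewrite adde_ge0 ?nir_ge0.
  have [uc _|cu] := leP u%:E c; first by rewrite (le_trans uc)// leeDr ?nir_ge0.
  rewrite lt_nir// (_ : [set _ | _] = [set x | u%:E < h0 x]); last first.
    apply/seteqP; split=> y /=; rewrite /h0 /F; last first.
      by case: ifP => // _; rewrite lte_fin ltNge u0.
    by move=> uy; rewrite (lt_trans cu uy).
  by rewrite -lt_nir// => /ltW/le_trans; apply; rewrite leeDl.
pose m x := mine (b x) c; pose k x := mine ((a \+ b) x) c.
have mm : nonneg_measurable m.
  split=> [|x]; first by apply: measurable_mine => //; exact: mb.1.
  by rewrite /m le_min c0 mb.2.
have mk : nonneg_measurable k.
  split=> [|x]; first by apply: measurable_mine => //; exact: mg.1.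
  by rewrite /k le_min c0; case: mg => _ ->.
(* The rearrangement of [m] is at most c on [0,1] and at most that of b beyond, so A sees b only
   through its global part and c. *)
have Am : A (xlift m) <= (C4 * (CG * r + (C1 + C2) * r))%:E.
  apply: (@bound2 _ _ _ _ (A (xlift (glb (nir mu b)))) c _ C40) => //; last first.
    apply: (bound1 CG0 (CGP _ mb)); apply: le_trans Bb.
    exact: (norm_glb_le ms HB).
  rewrite -(norm_nir HA ms mm); apply: C4P => // [||x].
  - exact/(measurable_glb ms)/decreasing_nir.
  - exact: (measurable_nir_comp ms).
  have s0 := s_ge0 x; rewrite /glb /sample /=; have [s1|s1] := leP (sigma_map mu x) 1%R.
    apply: (@le_trans _ _ c); last by rewrite leeDr// nir_ge0.
    by apply: nir_le_bound => // y; rewrite /m ge_min lexx orbT.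
  rewrite adde0; apply: le_nir => //.
  by apply: aeW => y; rewrite /m ge_min lexx.
(* This rests on min(a + b, c) <= a + min(b, c). *)
have Ak : A (xlift k) <= (KA * (r + C4 * (CG * r + (C1 + C2) * r)))%:E.
  apply: (@bound2 _ _ _ _ (A (xlift a)) (A (xlift m)) _ KA0) => //.
  apply: le_trans (KAP _ _ ma mm); apply: (le_norm HA) => // [|x].
    split=> [|x]; first by apply: emeasurable_funD; [exact: ma.1|exact: mm.1].
    by rewrite adde_ge0//; [exact: ma.2|exact: mm.2].
  rewrite /k /m /=; have [bc|cb] := leP (b x) c.
    by rewrite ge_min lexx.
  by rewrite ge_min leeDr ?orbT//; exact: ma.2.
(* At max(s,1) only levels u < c occur, and for these [k] and a + b have the same superlevel
   sets. *)
have Atail : A (xlift (tail (nir mu (a \+ b)))) <=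
    (KA * (r + C4 * (CG * r + (C1 + C2) * r)))%:E.
  apply: le_trans (norm_tail_le ms HA dg) _; apply: le_trans Ak.
  rewrite -(norm_nir HA ms mk); apply: (le_norm HA) => [||x].
  - exact: (measurable_glb ms).
  - exact: (measurable_nir_comp ms).
  have s0 := s_ge0 x; rewrite /glb /sample /=.
  set t := Num.max _ _.
  have t1 : (1 <= t)%R by rewrite le_max lexx orbT.
  have t0 : (0 <= t)%R by exact: le_trans t1.
  have st : (sigma_map mu x <= t)%R by rewrite le_max lexx.
  apply: le_of_lt_real => [|u u0 ut]; first exact: nir_ge0.
  have uc : u%:E < c by apply: lt_le_trans ut (nir_nonincreasing _ _ t1).
  apply: ltW; rewrite lt_nir//.
  rewrite (_ : [set _ | _] = [set x | u%:E < (a \+ b) x]); last first.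
    by apply/seteqP; split=> y /=; rewrite /k lt_min uc andbT.
  by apply: (@le_lt_trans _ _ t%:E); rewrite ?lee_fin// -lt_nir.
apply: le_trans (leeD Bloc Atail) _; rewrite -EFinD lee_fin.
by rewrite le_eqVlt; apply/orP; left; apply/eqP; ring.
Qed.

Lemma sum_embeds_WL : local_stronger mu A B -> global_stronger mu B A ->
  embeds (sum_norm mu A B) (WL mu B A).
Proof.
move=> locAB globBA; have [P [P0 PP]] := sum_estimate locAB globBA.
(* Adding 1 makes the constant positive, so one may divide by it and test the infimum on each
   decomposition. *)
have P1 : (0 < 1 + P)%R by rewrite ltr_pwDl.
exists (1 + P)%R; split=> [|f mf]; first exact: ltW.
rewrite -lee_pdivrMl//; apply: le_ereal_inf_tmp => _ [fA [fB [[mfA Afin] [mfB Bfin] fE ->]]].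
rewrite lee_pdivrMl// (WLE _ HB HA).
have ma := measurable_modulus mfA; have mb := measurable_modulus mfB.
have A0 : 0 <= A fA by exact: (rqn_ge0 HA).
have B0 : 0 <= B fB by exact: (rqn_ge0 HB).
have AE : A fA = (fine (A fA))%:E by rewrite fineK// ge0_fin_numE.
have BE : B fB = (fine (B fB))%:E by rewrite fineK// ge0_fin_numE.
set u := fine (A fA) in AE; set v := fine (B fB) in BE.
have u0 : (0 <= u)%R by exact: fine_ge0.
have v0 : (0 <= v)%R by exact: fine_ge0.
have mg : nonneg_measurable (modulus fA \+ modulus fB).
  split=> [|x]; first by apply: emeasurable_funD; [exact: ma.1|exact: mb.1].
  by rewrite adde_ge0// modulus_ge0.
have mh := measurable_modulus mf.
have fg t : nir mu (modulus f) t <= nir mu (modulus fA \+ modulus fB) t.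
  apply: le_nir => //; apply: filterS fE => x; rewrite /modulus /= => ->.
  case: (fA x) => [z|] /=; last by rewrite addye// gt_eqF// (lt_le_trans _ (xmod_ge0 _)).
  case: (fB x) => [w|] /=; last by rewrite leey.
  by rewrite -EFinD lee_fin; exact: le_normcD.
have dh := decreasing_nir mu (modulus f).
have dg := decreasing_nir mu (modulus fA \+ modulus fB).
apply: (@le_trans _ _ (P * (u + v))%:E); last first.
  by rewrite AE BE -EFinD -EFinM lee_fin ler_wpM2r ?addr_ge0// lerDr.
apply: le_trans (PP _ _ (u + v)%R ma mb _ _ _).
- apply: leeD.
    apply: (le_norm HB) => [||x]; [exact: (measurable_loc ms)..|].
    by apply: (le_loc ms).
  apply: (le_norm HA) => [||x]; [exact: (measurable_tail ms)..|].
  by apply: (le_tail ms).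
- exact: addr_ge0.
- by rewrite -(norm_modulus HA mfA) AE lee_fin lerDl.
- by rewrite -(norm_modulus HB mfB) BE lee_fin lerDr.
Qed.

End Amalgams.

Lemma xaddC {R : realType} (z w : xcomplex R) : xadd z w = xadd w z.
Proof. by case: z => [z|]; case: w => [w|] //=; rewrite addrC. Qed.

Lemma sum_normC {R : realType} {d : measure_display} {T : measurableType d}
  (mu : {measure set T -> \bar R}) (A B : (T -> xcomplex R) -> \bar R) f :
  sum_norm mu A B f = sum_norm mu B A f.
Proof.
rewrite /sum_norm; congr ereal_inf; apply/seteqP.
by split=> r [fA [fB [iA iB fE ->]]]; exists fB, fA; split; rewrite 1?addeC//;
  apply: filterS fE => x ->; rewrite xaddC.
Qed.

Theorem theorem3p4 (R : realType) (d : measure_display) (T : measurableType d)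
    (mu : {sigma_finite_measure set T -> \bar R})
    (A B : (T -> xcomplex R) -> \bar R) :
  non_atomic mu -> mu [set: T] = +oo ->
  ri_quasi_norm mu A -> ri_quasi_norm mu B ->
  [/\ embeds (cap_norm A B) (WL mu A B),
      embeds (WL mu A B) (sum_norm mu A B) &
      local_stronger mu A B -> global_stronger mu B A ->
      equivalent_norms (cap_norm A B) (WL mu A B) /\
      equivalent_norms (sum_norm mu A B) (WL mu B A)].
Proof.
move=> NA muT HA HB.
have ms : measure_preserving mu (sigma_map mu).
  have [s sP] := measure_preserving_exists (sigma_finiteT mu) muT NA.
  exact: (@xgetPex _ _ [set s | measure_preserving mu s] (ex_intro _ s sP)).
split; [exact: cap_embeds_WL|exact: WL_embeds_sum|move=> locAB globBA].
split; split.
- exact: cap_embeds_WL.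
- exact: WL_embeds_cap.
- exact: sum_embeds_WL.
(* The general embedding with A and B exchanged, the sum being symmetric. *)
- have [C [C0 CP]] := WL_embeds_sum ms HB HA.
  by exists C; split=> // f mf; rewrite sum_normC; exact: CP.
Qed.
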